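(* Let $\mu\in\mathbb R$, $v<u$, $t>0$, $n\ge 1$, and $0=s_0<s_1<\cdots<s_n<t$. Put $y_0=u$. Then for $y_1,\dots,y_n>v$, $$ P\Big\{\bigcap_{j=1}^n (B^\mu(s_j)\in \mathrm dy_j)\,\Big|\,\min_{0\le z\le t}B^\mu(z)>v,\ B^\mu(0)=u\Big\} $$ $$ =\prod_{j=1}^n\left[\frac{e^{-\frac{(y_j-y_{j-1}-\mu(s_j-s_{j-1}))^2}{2(s_j-s_{j-1})}}}{\sqrt{2\pi(s_j-s_{j-1})}}-e^{-2\mu(y_{j-1}-v)}\frac{e^{-\frac{(y_j+y_{j-1}-2v-\mu(s_j-s_{j-1}))^2}{2(s_j-s_{j-1})}}}{\sqrt{2\pi(s_j-s_{j-1})}}\right]\mathrm dy_j\ \times\ \frac{P\{\min_{s_n\le z\le t}B^\mu(z)>v\mid B^\mu(s_n)=y_n\}}{P\{\min_{0\le z\le t}B^\mu(z)>v\mid B^\mu(0)=u\}} $$ $$ =\prod_{j=1}^n\left[\frac{e^{-\frac{(y_j-y_{j-1})^2}{2(s_j-s_{j-1})}}-e^{-\frac{(2v-y_j-y_{j-1})^2}{2(s_j-s_{j-1})}}}{\sqrt{2\pi(s_j-s_{j-1})}}\right]\mathrm dy_j\ \times\ \frac{\displaystyle\int_v^\infty\frac{e^{-\frac{(w-y_n)^2}{2(t-s_n)}}-e^{-\frac{(2v-w-y_n)^2}{2(t-s_n)}}}{\sqrt{2\pi(t-s_n)}}\,e^{\mu w}\,\mathrm dw}{\displaystyle\int_v^\infty\frac{e^{-\frac{(w-u)^2}{2t}}-e^{-\frac{(2v-w-u)^2}{2t}}}{\sqrt{2\pi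 t}}\,e^{\mu w}\,\mathrm dw}. $$
   Context: $B$ is a standard one-dimensional Brownian motion and $B^\mu(t)=B(t)+\mu t$ is Brownian motion with drift $\mu\in\mathbb R$. $P(\cdot\mid B^\mu(0)=u)$ denotes the law of the process started at $u$, i.e. under which $B(0)=u$ almost surely; similarly $P(\cdot\mid B^\mu(s)=y)$ denotes the law of the process after time $s$ started from $y$ at time $s$. For $u>v$ the event $\{\min_{0\le z\le t}B^\mu(z)>v\}$ has positive probability under this law, and the conditioning on it is elementary conditioning. An identity of the form $P\{\bigcap_j(B^\mu(s_j)\in\mathrm dy_j)\mid\cdot\}=f(y_1,\dots,y_n)\prod_j\mathrm dy_j$ means that $f$ is the joint conditional density of $(B^\mu(s_1),\dots,B^\mu(s_n))$ on $(v,\infty)^n$ with respect to Lebesgue measure. *)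

(* Defs.v *)
From HB Require Import structures.
From mathcomp Require Import all_boot all_order all_algebra.
From mathcomp Require Import all_classical all_reals all_analysis.

Set Implicit Arguments.
Unset Strict Implicit.
Unset Printing Implicit Defensive.

Import Order.TTheory GRing.Theory Num.Theory.
Import numFieldNormedType.Exports.

Local Open Scope classical_set_scope.
Local Open Scope ring_scope.

(* Lebesgue measure on R^n (n.-tuple R with its product sigma-algebra) is
   built by induction: lambda_0 is the Dirac mass at the empty tuple, and
   lambda_(n+1) is the image of lambda \x lambda_n by (x, y) |-> x :: y.
   [lebesgue_tuple_box] is the value on measurable rectangles. *)
Section lebesgue_tuple.
Context {R : realType}.

Definition cons_pair n (p : measurableTypeR R * n.-tuple (measurableTypeR R)) :
    n.+1.-tuple (measurableTypeR R) :=
  [tuple of p.1 :: p.2].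

Lemma behead_cons_pair n p : [tuple of behead (@cons_pair n p)] = p.2.
Proof. exact/val_inj. Qed.

Lemma measurable_cons_pair n : measurable_fun [set: _] (@cons_pair n).
Proof. by apply: measurable_cons. Qed.

Section step.
Variables (n : nat)
  (m : {sigma_finite_measure set (n.-tuple (measurableTypeR R)) -> \bar R}).

Definition lebesgue_step : set (n.+1.-tuple (measurableTypeR R)) -> \bar R :=
  pushforward (@lebesgue_measure R \x m)%E (@cons_pair n).

Let lebesgue_step0 : lebesgue_step set0 = 0%E.
Proof. by rewrite /lebesgue_step /pushforward preimage_set0 measure0. Qed.

Let lebesgue_step_ge0 A : (0 <= lebesgue_step A)%E.
Proof. by rewrite /lebesgue_step /pushforward measure_ge0. Qed.

Let lebesgue_step_sigma_additive : semi_sigma_additive lebesgue_step.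
Proof.
move=> F mF tF mUF; rewrite /lebesgue_step /pushforward preimage_bigcup.
have mp A : measurable A -> measurable (@cons_pair n @^-1` A).
  by move=> mA; have := measurable_cons_pair measurableT mA; rewrite setTI.
apply: measure_semi_sigma_additive => [k||].
- exact: mp.
- apply/trivIsetP => i j _ _ ij; rewrite -preimage_setI.
  by move/trivIsetP : tF => /(_ _ _ Logic.I Logic.I ij) ->; rewrite preimage_set0.
- by rewrite -preimage_bigcup; exact: mp.
Qed.

HB.instance Definition _ := isMeasure.Build _ _ _ lebesgue_step
  lebesgue_step0 lebesgue_step_ge0 lebesgue_step_sigma_additive.

Lemma lebesgue_step_box (A : set (measurableTypeR R))
    (C : set (n.-tuple (measurableTypeR R))) :
  measurable A -> measurable C ->
  lebesgue_step [set z | A (thead z) /\ C [tuple of behead z]] =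
  (@lebesgue_measure R A * m C)%E.
Proof.
move=> mA mC; rewrite -product_measure1E//; congr (product_measure1 _ _ _).
by apply/seteqP; split => -[x y] /=; rewrite behead_cons_pair theadE.
Qed.

Lemma lebesgue_step_sigma_finite : sigma_finite setT lebesgue_step.
Proof.
have /sigma_finiteP[F [TF ndF Foo]] := sigma_finiteT (@lebesgue_measure R).
have /sigma_finiteP[G [TG ndG Goo]] := sigma_finiteT m.
exists (fun k => [set z | F k (thead z) /\ G k [tuple of behead z]]).
  apply/seteqP; split => [z _|//].
  have [i _ Fi] : (\bigcup_k F k) (thead z) by rewrite -TF.
  have [j _ Gj] : (\bigcup_k G k) [tuple of behead z] by rewrite -TG.
  exists (maxn i j) => //; split.
    by move: Fi; exact/subsetPset/ndF/leq_maxl.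
  by move: Gj; exact/subsetPset/ndG/leq_maxr.
move=> k; have [mF Fk] := Foo k; have [mG Gk] := Goo k; split.
  apply: measurableI.
    by have := @measurable_tnth _ (measurableTypeR R) n.+1 ord0 measurableT
      _ mF; rewrite setTI.
  by have := @measurable_behead _ (measurableTypeR R) n measurableT _ mG;
    rewrite setTI.
by rewrite lebesgue_step_box// lte_mul_pinfty// ge0_fin_numE.
Qed.

HB.instance Definition _ := Measure_isSigmaFinite.Build _ _ _ lebesgue_step
  lebesgue_step_sigma_finite.

End step.

Fixpoint lebesgue_tuple n :
    {sigma_finite_measure set (n.-tuple (measurableTypeR R)) -> \bar R} :=
  match n with
  | 0 => \d_([tuple] : 0.-tuple (measurableTypeR R))
  | n'.+1 => lebesgue_step (lebesgue_tuple n')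
  end.

Lemma lebesgue_tuple_box n (A : 'I_n -> set (measurableTypeR R)) :
  (forall i, measurable (A i)) ->
  lebesgue_tuple n [set y | forall i, A i (tnth y i)] =
  (\prod_(i < n) @lebesgue_measure R (A i))%E.
Proof.
elim: n A => [|n IHn] A mA.
  by rewrite big_ord0 /= diracE mem_set// => -[].
rewrite big_ord_recl -IHn; last by move=> i; exact: mA.
rewrite /= -lebesgue_step_box//; last first.
  rewrite [X in measurable X](_ : _ =
      \bigcap_(i in setT) ((@tnth n _)^~ i @^-1` A (lift ord0 i))).
    apply: fin_bigcap_measurable => // i _.
    by have := @measurable_tnth _ (measurableTypeR R) n i measurableT _
      (mA (lift ord0 i)); rewrite setTI.
  by apply/seteqP; split => y Ay i => [_|]; exact: Ay.
have tnthB (z : n.+1.-tuple (measurableTypeR R)) i :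
    tnth [tuple of behead z] i = tnth z (lift ord0 i).
  by rewrite [in RHS](tuple_eta z) tnthS.
congr (lebesgue_step _ _); apply/seteqP; split => z /=.
  by move=> Az; split=> [|i]; [exact: Az|rewrite tnthB].
by move=> [A0 Ai] i; have [j ->|->//] := unliftP ord0 i; rewrite -tnthB.
Qed.

End lebesgue_tuple.

Section brownian_motion.
Context {R : realType} {d : measure_display} {T : measurableType d}.
Implicit Types (P : probability T R) (B X : R -> T -> R) (Pr : R -> R -> probability T R).

Definition mutually_independent P n (Y : 'I_n -> T -> R) :=
  forall A : 'I_n -> set (measurableTypeR R), (forall i, measurable (A i)) ->
    P [set w | forall i, A i (Y i w)] = (\prod_(i < n) P (Y i @^-1` A i))%E.

(* [B] is, after time [s] and up to its value at time [s], a standard Brownian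
   motion under [P]; its values before time [s] are irrelevant.  All sample
   paths are continuous, which makes the events on the running minimum
   measurable without completing [P]. *)
Record brownian_after P B (s : R) : Prop := BrownianAfter {
  brownian_measurable : forall a, s <= a -> measurable_fun [set: T] (B a);
  brownian_continuous : forall w, {within `[s, +oo[, continuous (B ^~ w)};
  (* the second parameter of [normal_prob] is the standard deviation *)
  brownian_gaussian : forall a b, s <= a -> a < b ->
    forall A : set (measurableTypeR R), measurable A ->
      P ((fun w => B b w - B a w) @^-1` A) =
      normal_prob 0 (Num.sqrt (b - a)) A;
  brownian_independent : forall n (r : nat -> R), s <= r 0%N ->
    (forall j, (j < n)%N -> r j < r j.+1) ->
    mutually_independent P
      (fun (j : 'I_n) w => B (r j.+1) w - B (r j) w) }.

Definition drifted (mu : R) B : R -> T -> R := fun z w => B z w + mu * z.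

(* [Pr s y] is the law P(. | B^mu(s) = y) of the process after time s started
   from y at time s. *)
Definition drifted_brownian_laws (mu : R) B Pr :=
  forall s y, 0 <= s ->
    brownian_after (Pr s y) B s /\
    Pr s y [set w | drifted mu B s w = y] = 1%E.

(* The paths of interest are continuous on the compact interval [a, b], so that
   this infimum is attained: it is the minimum of X over [a, b]. *)
Definition path_min X (a b : R) (w : T) : R := inf [set X z w | z in `[a, b]].

Definition cond_prob P (A E : set T) : R := fine (P (A `&` E)) / fine (P E).

(* [f] is on [D] the density, with respect to Lebesgue measure on R^n, of the
   conditional law of [Y] given the event [E]. *)
Definition joint_cond_density P (E : set T) n
    (Y : T -> n.-tuple (measurableTypeR R))
    (D : set (n.-tuple (measurableTypeR R)))
    (f : n.-tuple (measurableTypeR R) -> R) :=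
  [/\ measurable_fun D f,
      forall y, D y -> 0 <= f y &
      forall A, measurable A -> A `<=` D ->
        (cond_prob P (Y @^-1` A) E)%:E =
        (\int[lebesgue_tuple n]_(y in A) (f y)%:E)%E].

End brownian_motion.

Section kernels.
Context {R : realType}.
Implicit Types mu v tau x y : R.

Definition drifted_killed_kernel mu v tau x y : R :=
  expR (- ((y - x - mu * tau) ^+ 2 / (2 * tau))) / Num.sqrt (2 * pi * tau)
  - expR (- (2 * mu * (x - v))) *
    (expR (- ((y + x - 2 * v - mu * tau) ^+ 2 / (2 * tau)))
     / Num.sqrt (2 * pi * tau)).

Definition killed_kernel v tau x y : R :=
  (expR (- ((y - x) ^+ 2 / (2 * tau)))
   - expR (- ((2 * v - y - x) ^+ 2 / (2 * tau))))
  / Num.sqrt (2 * pi * tau).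

End kernels.

(* Main.v *)
Require Import Defs.
From HB Require Import structures.
From mathcomp Require Import all_boot all_order all_algebra.
From mathcomp Require Import all_classical all_reals all_analysis.
From mathcomp Require Import measurable_realfun ring lra.

Set Implicit Arguments.
Unset Strict Implicit.
Unset Printing Implicit Defensive.

Import Order.TTheory GRing.Theory Num.Theory.
Import numFieldNormedType.Exports.

Local Open Scope classical_set_scope.
Local Open Scope ring_scope.

(** The process conditioned to stay above v is Brownian motion with drift killed
    when it hits v, renormalised. So everything follows from one formula: for times
    s 0 < ... < s n < t and measurable sets A i of positions, the probability that
    the path started from x visits each A i at time s i.+1 and stays above v up to
    time t is the iterated integral, over the A i and over the last position, of
    the transition kernel of the killed process. That kernel is the difference of
    two Gaussians given by the method of images, times a Cameron-Martin factor for
    the drift. With n = 0 the formula gives the two survival probabilities of the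
    statement, and the Cameron-Martin factors telescope in their quotient, which
    yields the second expression.

    The formula is proved without stopping times. Independence of the increments
    gives the probability that the path is above v at finitely many times as an
    iterated integral of the free heat kernel over half-lines ([integral_visits]).
    When the grid is refined these integrals converge to those of the killed
    kernel. From below this is the inequality between the two kernels and the
    semigroup property of the killed one ([absorb_semigroup], [absorb_le_walk]).
    From above ([walk_le_absorb], [walk_cvg_absorb]), the discrepancy created by
    one step is the value of the killed semigroup reflected at the level, averaged
    over the overshoot of the walk. A multiple of the hyperbolic sine of the
    distance to v, an eigenfunction of the killed semigroup ([absorb_sinhat]),
    dominates that value. As the walk exits at most once, the total discrepancy is
    at most the value of this function at the overshoot, and overshoots of a
    fixed height have a probability that is small compared with the length of a
    step.

    Continuity of the paths enters only through the description of survival by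
    grids: the minimum is above v if and only if, for some level above v, the path
    is above that level at all points of a sequence of nested grids
    ([visits_above]). Each such level leaves a gap that makes the domination by the
    hyperbolic sine possible, and the killed kernels increase to the one of v when
    the level decreases to v ([absorb_chain_cvg]). Finally, boxes determine finite measures
    on tuples, which turns the formula into a density ([law_absorbed_path]). *)

(** * Reflections of Lebesgue measure and the heat kernel *)

Section lebesgue_affine.
Context {R : realType}.
Notation leb := (@lebesgue_measure R).
Local Open Scope ereal_scope.

Lemma ge0_integral_reflect (c : R) (A : set (measurableTypeR R))
    (f : R -> \bar R) :
  measurable A -> measurable_fun [set: R] f ->
  (forall x, 0 <= f x) ->
  \int[leb]_(x in A) f x =
  \int[leb]_(x in (fun z : R => (c - z)%R) @^-1` A) f (c - x)%R.
Proof.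
move=> mA mf f0.
have mr : measurable_fun [set: measurableTypeR R]
    ((fun z : R => c - z)%R : measurableTypeR R -> measurableTypeR R).
  exact: measurable_funB.
rewrite -(ge0_integral_pushforward mr)//; last exact: measurable_funTS.
apply: eq_measure_integral => X mX _.
apply: lebesgue_measure_unique => // _ [[a b]] _ <-.
rewrite /pushforward /=.
rewrite [X in _ = leb X](_ : _ = `[(c - b)%R, (c - a)%R[%classic); last first.
  by apply/seteqP; split => z /=; rewrite !in_itv/= => /andP[? ?]; lra.
rewrite !lebesgue_measure_itv/= !lte_fin ltrD2l ltrN2.
by case: ifP => // _; congr (_%:E); ring.
Qed.

Lemma ge0_integral_shift (c : R) (f : R -> \bar R) :
  measurable_fun [set: R] f -> (forall x, 0 <= f x) ->
  \int[leb]_x f x = \int[leb]_x f (c + x)%R.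
Proof.
move=> mf f0; rewrite (@ge0_integral_reflect c)// preimage_setT.
rewrite (@ge0_integral_reflect 0%R) ?preimage_setT//; last first.
  by apply: measurableT_comp => //; exact: measurable_funB.
by apply: eq_integral => x _; rewrite sub0r opprK.
Qed.

(** Folding the line at v; the fold itself is Lebesgue-null. *)
Lemma ge0_integral_fold (v : R) (f : R -> \bar R) :
  measurable_fun [set: R] f -> (forall x, 0 <= f x) ->
  \int[leb]_x f x =
  \int[leb]_(x in `]v, +oo[) (f x + f (2 * v - x)%R).
Proof.
move=> mf f0.
have mr : measurable_fun [set: R] (fun x => f (2 * v - x)%R).
  by apply: measurableT_comp => //; exact: measurable_funB.
rewrite ge0_integralD//; [|exact: measurable_funTS|exact: measurable_funTS].
rewrite -(setUv (`]v, +oo[%classic : set R)) ge0_integral_setU//; last first.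
- by rewrite disj_set2E setICr.
- by rewrite setUv.
- exact: measurableC.
congr (_ + _).
rewrite (@ge0_integral_reflect (2 * v)%R)//; last exact: measurableC.
have -> : ((fun z : R => 2 * v - z)%R @^-1` (~` `]v, +oo[) = `[v, +oo[)%classic.
  apply/seteqP; split => z /=; rewrite !in_itv/= !andbT; last by move=> ? /=; lra.
  by move/negP; rewrite -leNgt; lra.
by rewrite -integral_itv_obnd_cbnd//; exact: measurable_funTS.
Qed.

End lebesgue_affine.

Section heat_kernel.
Context {R : realType}.
Notation leb := (@lebesgue_measure R).
Notation mR := (measurableTypeR R).
Implicit Types (t x y v a b : R) (h : mR -> \bar R) (k : R -> R -> R).

Definition heat t x y : R :=
  expR (- ((y - x) ^+ 2 / (2 * t))) / Num.sqrt (2 * pi * t).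

Lemma heat_ge0 t x y : 0 <= heat t x y.
Proof. by rewrite divr_ge0 ?expR_ge0. Qed.

Lemma heat_reflect t x y v : heat t (2 * v - x) (2 * v - y) = heat t x y.
Proof.
rewrite /heat (_ : 2 * v - y - (2 * v - x) = - (y - x)) ?sqrrN//; ring.
Qed.

Lemma killed_kernelE v t x y :
  killed_kernel v t x y = heat t x y - heat t (2 * v - x) y.
Proof.
rewrite /killed_kernel mulrBl /heat.
rewrite (_ : 2 * v - y - x = - (y - (2 * v - x))) ?sqrrN//; ring.
Qed.

Lemma heat_normal t x y : 0 < t -> heat t x y = normal_pdf x (Num.sqrt t) y.
Proof.
move=> t0; rewrite normal_pdfE ?gt_eqF ?sqrtr_gt0//.
rewrite /normal_peak /normal_fun sqr_sqrtr ?ltW// mulrC /heat.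
congr (expR _ / Num.sqrt _).
  by rewrite mulNr -(mulr_natl t).
by rewrite -(mulr_natl (t * pi)) -mulrA (mulrC pi).
Qed.

Lemma measurable_heat t :
  measurable_fun [set: mR * mR] (fun z : mR * mR => heat t z.1 z.2).
Proof.
apply: measurable_funM => //; apply: measurableT_comp => //.
apply: measurableT_comp => //; apply: measurable_funM => //.
by apply: measurable_funX; exact: measurable_funB.
Qed.

Lemma integral_heat t x : 0 < t -> (\int[leb]_y (heat t x y)%:E = 1)%E.
Proof.
move=> t0; under eq_integral do rewrite heat_normal//.
exact: integral_normal_pdf.
Qed.

(** Completing the square: an exponential tilt of the heat kernel is a
    translate of it. *)
Lemma heat_tilt t x y a : 0 < t ->
  heat t x y * expR (a * y) =
  expR (a * x + a ^+ 2 * t / 2) * heat t (x + a * t) y.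
Proof.
move=> t0; rewrite /heat mulrAC mulrA -!expRD; congr (expR _ / _).
by field; rewrite gt_eqF.
Qed.

(** The product of two heat kernels is, in the middle point, a Gaussian centred
    at the mean of the bridge between the two ends. *)
Lemma heat_mul t s x y z : 0 < t -> 0 < s ->
  heat t x y * heat s y z =
  heat (t + s) x z * heat (t * s / (t + s)) ((s * x + t * z) / (t + s)) y.
Proof.
move=> t0 s0; have ts : 0 < t + s by rewrite addr_gt0.
rewrite /heat !mulf_div -!expRD -!sqrtrM ?mulr_ge0 ?pi_ge0 ?ltW//.
move: pi (pi_gt0 R) => p p0.
by congr (expR _ / Num.sqrt _); field; rewrite ?gt_eqF.
Qed.

Lemma heat_convolution t s x z : 0 < t -> 0 < s ->
  (\int[leb]_y (heat t x y * heat s y z)%:E = (heat (t + s) x z)%:E)%E.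
Proof.
move=> t0 s0; have ts : 0 < t + s by rewrite addr_gt0.
under eq_integral do rewrite heat_mul// EFinM.
rewrite ge0_integralZl_EFin ?heat_ge0//.
- by rewrite integral_heat ?mule1// divr_gt0 ?mulr_gt0.
- by move=> y _; rewrite lee_fin heat_ge0.
- by apply/measurable_EFinP; exact: (measurableT_comp (measurable_heat _) (measurable_pair1 _)).
Qed.

End heat_kernel.

(** * Chains of kernel operators *)

Section kernel_operators.
Context {R : realType}.
Notation leb := (@lebesgue_measure R).
Notation mR := (measurableTypeR R).
Implicit Types (x y : R) (A : set mR) (h : R -> \bar R) (k : R -> R -> R).
Local Open Scope ereal_scope.

Definition kernel_op k A h x : \bar R := \int[leb]_(y in A) ((k x y)%:E * h y).

Definition jointly_measurable k :=
  measurable_fun [set: mR * mR] (fun z : mR * mR => k z.1 z.2).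

Lemma measurable_kernel_integrand k A h x : jointly_measurable k ->
  measurable_fun [set: R] h -> measurable_fun A (fun y => (k x y)%:E * h y).
Proof.
move=> mk mh; apply: measurable_funTS; apply: emeasurable_funM => //.
by apply/measurable_EFinP; exact: (measurableT_comp mk (measurable_pair1 _)).
Qed.

Lemma kernel_op_ge0 k A h x : (forall y, A y -> 0 <= k x y)%R ->
  (forall y, 0 <= h y) -> 0 <= kernel_op k A h x.
Proof.
by move=> k0 h0; apply: integral_ge0 => y Ay; rewrite mule_ge0// lee_fin k0.
Qed.

Lemma measurable_kernel_op k A h : measurable A -> jointly_measurable k ->
  (forall x y, A y -> 0 <= k x y)%R ->
  measurable_fun [set: R] h -> (forall y, 0 <= h y) ->
  measurable_fun [set: R] (kernel_op k A h).
Proof.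
move=> mA mk k0 mh h0.
pose f := (fun z : mR * mR => (k z.1 z.2)%:E * h z.2) \_ ([set: mR] `*` A).
have mf : measurable_fun [set: mR * mR] f.
  apply/(measurable_restrictT _ _).1; first exact: measurableX.
  apply: measurable_funTS; apply: emeasurable_funM; first exact/measurable_EFinP.
  exact: measurableT_comp.
have f0 z : 0 <= f z.
  by apply: erestrict_ge0 => -[x y] [_ /= Ay]; rewrite mule_ge0// lee_fin k0.
have := measurable_fun_fubini_tonelli_F (m2 := leb) _ mf f0; congr measurable_fun.
apply/funext => x; rewrite /kernel_op [RHS]integral_mkcond; apply: eq_integral.
by move=> y _; rewrite /f /patch in_setX in_setT.
Qed.

Lemma le_kernel_op k A h1 h2 x : measurable A -> jointly_measurable k ->
  (forall y, A y -> 0 <= k x y)%R ->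
  measurable_fun [set: R] h1 -> measurable_fun [set: R] h2 ->
  (forall y, 0 <= h1 y) -> (forall y, A y -> h1 y <= h2 y) ->
  kernel_op k A h1 x <= kernel_op k A h2 x.
Proof.
move=> mA mk k0 mh1 mh2 h10 h12; apply: ge0_le_integral => //.
- by move=> y Ay; rewrite mule_ge0// lee_fin k0.
- exact: measurable_kernel_integrand.
- exact: measurable_kernel_integrand.
- by move=> y Ay; apply: lee_wpmul2l; rewrite ?lee_fin; [exact: k0|exact: h12].
Qed.

Lemma kernel_opD k A h1 h2 x : measurable A -> jointly_measurable k ->
  (forall y, A y -> 0 <= k x y)%R ->
  measurable_fun [set: R] h1 -> measurable_fun [set: R] h2 ->
  (forall y, 0 <= h1 y) -> (forall y, 0 <= h2 y) ->
  kernel_op k A (h1 \+ h2) x = kernel_op k A h1 x + kernel_op k A h2 x.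
Proof.
move=> mA mk k0 mh1 mh2 h10 h20; rewrite -ge0_integralD//.
- by apply: eq_integral => y Ay; rewrite ge0_muleDr.
- by move=> y Ay; rewrite mule_ge0// lee_fin k0.
- exact: measurable_kernel_integrand.
- by move=> y Ay; rewrite mule_ge0// lee_fin k0.
- exact: measurable_kernel_integrand.
Qed.

Lemma kernel_opZ k A (c : R) h x : measurable A -> jointly_measurable k ->
  (forall y, A y -> 0 <= k x y)%R -> measurable_fun [set: R] h ->
  (forall y, 0 <= h y) -> (0 <= c)%R ->
  kernel_op k A (fun y => c%:E * h y) x = c%:E * kernel_op k A h x.
Proof.
move=> mA mk k0 mh h0 c0; rewrite -ge0_integralZl_EFin//.
- by apply: eq_integral => y _; rewrite muleCA.
- by move=> y Ay; rewrite mule_ge0// lee_fin k0.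
- exact: measurable_kernel_integrand.
Qed.

Lemma eq_kernel_op k A h1 h2 x : (forall y, A y -> h1 y = h2 y) ->
  kernel_op k A h1 x = kernel_op k A h2 x.
Proof.
by move=> h12; apply: eq_integral => y /set_mem Ay; rewrite h12.
Qed.

Definition chain (k : R -> R -> R -> R) (l : seq (R * set mR)) h :=
  foldr (fun p g => kernel_op (k p.1) p.2 g) h l.

Section nonnegative_chain.
Variable k : R -> R -> R -> R.
Hypothesis mk : forall t, jointly_measurable (k t).
Hypothesis k0 : forall t x y, (0 <= k t x y)%R.

Definition measurable_steps (l : seq (R * set mR)) :=
  forall p, p \in l -> measurable p.2.

Lemma measurable_steps_cons p l :
  measurable_steps (p :: l) -> measurable p.2 /\ measurable_steps l.
Proof.
by move=> ml; split=> [|q ql]; apply: ml; rewrite in_cons ?eqxx ?ql ?orbT.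
Qed.

Lemma chain_ge0 l h : (forall y, 0 <= h y) -> forall x, 0 <= chain k l h x.
Proof.
by move=> h0; elim: l => //= p l IHl x; apply: kernel_op_ge0 => // y _.
Qed.

Lemma measurable_chain l h : measurable_steps l -> measurable_fun [set: R] h ->
  (forall y, 0 <= h y) -> measurable_fun [set: R] (chain k l h).
Proof.
move=> + mh h0; elim: l => //= p l IHl /measurable_steps_cons[mp ml].
by apply: measurable_kernel_op => //; [exact: IHl|exact: chain_ge0].
Qed.

Lemma chain_cat l1 l2 h : chain k (l1 ++ l2) h = chain k l1 (chain k l2 h).
Proof. exact: foldr_cat. Qed.

End nonnegative_chain.

End kernel_operators.

(** * The absorbed heat semigroup *)

Section absorbed_heat.
Context {R : realType}.
Notation leb := (@lebesgue_measure R).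
Notation mR := (measurableTypeR R).
Variable v : R.
Implicit Types (t s x y a b l : R) (h : R -> \bar R).
Notation V := (`]v, +oo[%classic : set mR).
Notation T t := (kernel_op (heat t) V).

(** Truncated to the half-line, so that it is nonnegative everywhere. *)
Definition absorb t x y : R :=
  if (v < x) && (v < y) then killed_kernel v t x y else 0.

Lemma absorbE t x y : v < x -> v < y -> absorb t x y = killed_kernel v t x y.
Proof. by rewrite /absorb => -> ->. Qed.

Lemma ge0_killed_kernel t x y : v < x -> v < y -> 0 <= killed_kernel v t x y.
Proof.
move=> vx vy; have [t0|t0] := ltP 0 t; last first.
  by rewrite /killed_kernel ler0_sqrtr ?invr0 ?mulr0// pmulr_rle0 ?mulr_gt0 ?pi_gt0.
rewrite /killed_kernel divr_ge0// subr_ge0 ler_expR lerN2.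
rewrite ler_pM2r ?invr_gt0 ?mulr_gt0//; nra.
Qed.

Lemma absorb_ge0 t x y : 0 <= absorb t x y.
Proof. by rewrite /absorb; case: ifP => // /andP[]; exact: ge0_killed_kernel. Qed.

Lemma measurable_absorb t : jointly_measurable (absorb t).
Proof.
rewrite /jointly_measurable.
have -> : (fun z : mR * mR => absorb t z.1 z.2) =
    (fun z : mR * mR => killed_kernel v t z.1 z.2) \_ (V `*` V).
  apply/funext => -[x y]; rewrite /absorb /patch /=.
  by rewrite in_setX /= !mem_setE /= !in_itv/= !andbT.
apply/(measurable_restrictT _ _).1; first exact: measurableX.
apply: measurable_funTS; rewrite (_ : (fun _ => _) =
    (fun z : mR * mR => heat t z.1 z.2 - heat t (2 * v - z.1) z.2)); last first.
  by apply/funext => -[x y]; rewrite killed_kernelE.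
apply: measurable_funB; first exact: measurable_heat.
have mg : measurable_fun [set: mR * mR]
    (fun z : mR * mR => ((2 * v - z.1, z.2) : mR * mR)).
  by apply: measurable_fun_pair => //; exact: (measurable_funB (f := cst (2 * v))).
exact: (measurableT_comp (measurable_heat t) mg).
Qed.

Notation S t := (kernel_op (absorb t) V).

Lemma heat_reflectE t x y : heat t x (2 * v - y) = heat t (2 * v - x) y.
Proof. by rewrite -(heat_reflect t (2 * v - x) y v) subKr. Qed.

Lemma heat_op_ge0 t h : (forall y, (0 <= h y)%E) -> forall x, (0 <= T t h x)%E.
Proof. by move=> h0 x; apply: kernel_op_ge0 => // y _; exact: heat_ge0. Qed.

Lemma measurable_heat_op t h : measurable_fun [set: R] h ->
  (forall y, (0 <= h y)%E) -> measurable_fun [set: R] (T t h).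
Proof.
move=> mh h0; apply: measurable_kernel_op => //; first exact: measurable_heat.
by move=> *; exact: heat_ge0.
Qed.

Lemma absorb_op_ge0 t h : (forall y, (0 <= h y)%E) -> forall x, (0 <= S t h x)%E.
Proof. by move=> h0 x; apply: kernel_op_ge0 => // y _; exact: absorb_ge0. Qed.

Lemma measurable_absorb_op t h : measurable_fun [set: R] h ->
  (forall y, (0 <= h y)%E) -> measurable_fun [set: R] (S t h).
Proof.
move=> mh h0; apply: measurable_kernel_op => //; first exact: measurable_absorb.
by move=> *; exact: absorb_ge0.
Qed.

Lemma measurable_reflect h : measurable_fun [set: R] h ->
  measurable_fun [set: R] (fun y => h (2 * v - y)).
Proof. by move=> mh; apply: measurableT_comp => //; exact: measurable_funB. Qed.

(** The mass that reaches the far side of the level from x is, by reflection,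
    the mass that reaches the near side from the mirror image of x. *)
Lemma heat_op_fold t h x : measurable_fun [set: R] h ->
  (forall y, (0 <= h y)%E) ->
  kernel_op (heat t) [set: R] h x =
  (T t h x + T t (fun y => h (2 * v - y)%R) (2 * v - x)%R)%E.
Proof.
move=> mh h0; rewrite /kernel_op (ge0_integral_fold v); last 2 first.
- exact: (measurable_kernel_integrand (A := setT) x (measurable_heat t) mh).
- by move=> y; rewrite mule_ge0// lee_fin heat_ge0.
under eq_integral do rewrite heat_reflectE.
rewrite ge0_integralD//.
- by move=> y _; rewrite mule_ge0// lee_fin heat_ge0.
- exact: measurable_kernel_integrand (measurable_heat t) mh.
- by move=> y _; rewrite mule_ge0// lee_fin heat_ge0.
- exact: measurable_kernel_integrand (measurable_heat t) (measurable_reflect mh).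
Qed.

Lemma heat_semigroup t s (A : set mR) h x : 0 < t -> 0 < s -> measurable A ->
  measurable_fun [set: R] h -> (forall y, (0 <= h y)%E) ->
  kernel_op (heat t) [set: R] (kernel_op (heat s) A h) x =
  kernel_op (heat (t + s)) A h x.
Proof.
move=> t0 s0 mA mh h0.
have -> : kernel_op (heat s) A h = kernel_op (heat s) [set: R] (h \_ A).
  apply/funext => y; rewrite /kernel_op integral_mkcond; apply: eq_integral.
  by move=> z _; rewrite /patch; case: ifP => //; rewrite mule0.
have -> : kernel_op (heat (t + s)) A h x =
    kernel_op (heat (t + s)) [set: R] (h \_ A) x.
  rewrite /kernel_op integral_mkcond; apply: eq_integral.
  by move=> z _; rewrite /patch; case: ifP => //; rewrite mule0.
have {mh} : measurable_fun [set: R] (h \_ A).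
  by apply/(measurable_restrictT _ _).1 => //; exact: measurable_funTS.
have {h0} : forall y, (0 <= (h \_ A) y)%E.
  by move=> y; apply: erestrict_ge0 => z _.
move: (h \_ A) => {mA A}h h0 mh.
rewrite /kernel_op.
pose f (z : mR * mR) := ((heat t x z.1)%:E * ((heat s z.1 z.2)%:E * h z.2))%E.
have mf : measurable_fun [set: mR * mR] f.
  apply: emeasurable_funM; last apply: emeasurable_funM.
  - apply/measurable_EFinP.
    have mhx := measurableT_comp (measurable_heat t) (measurable_pair1 (x : mR)).
    exact: (measurableT_comp mhx (@measurable_fst _ _ mR mR)).
  - by apply/measurable_EFinP; exact: (measurable_heat s).
  - exact: (measurableT_comp mh (@measurable_snd _ _ mR mR)).
have f0 z : (0 <= f z)%E by rewrite !mule_ge0// lee_fin heat_ge0.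
transitivity (\int[leb]_y \int[leb]_z f (y, z))%E.
  apply: eq_integral => y _; rewrite /f /= ge0_integralZl_EFin ?heat_ge0//.
  - by move=> z _; rewrite mule_ge0// lee_fin heat_ge0.
  - exact: (measurable_kernel_integrand (A := setT) y (measurable_heat s) mh).
rewrite (fubini_tonelli f)//; apply: eq_integral => z _.
under eq_integral do rewrite /f /= muleA -EFinM muleC.
rewrite ge0_integralZl//.
- by rewrite heat_convolution// muleC.
- apply/measurable_EFinP/measurable_funM.
    exact: (measurableT_comp (measurable_heat t) (measurable_pair1 _)).
  exact: (measurableT_comp (measurable_heat s) (measurable_pair2 _)).
- by move=> y _; rewrite lee_fin mulr_ge0 ?heat_ge0.
Qed.

(** Method of images: the mass that a free particle carries above the level is
    the mass that has avoided the level plus the mass that has hit it, and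
    reflection after the hitting time turns the latter into the mass coming from
    the mirror image of the starting point. *)
Lemma absorb_image t h x : v < x -> measurable_fun [set: R] h ->
  (forall y, (0 <= h y)%E) -> T t h x = (S t h x + T t h (2 * v - x)%R)%E.
Proof.
move=> vx mh h0; rewrite /kernel_op -ge0_integralD//.
- apply: eq_integral => y; rewrite inE/= in_itv/= andbT => vy.
  rewrite -ge0_muleDl ?lee_fin ?absorb_ge0 ?heat_ge0// -EFinD.
  by rewrite [absorb t x y]absorbE// killed_kernelE subrK.
- by move=> y _; rewrite mule_ge0// lee_fin absorb_ge0.
- exact: measurable_kernel_integrand (measurable_absorb t) mh.
- by move=> y _; rewrite mule_ge0// lee_fin heat_ge0.
- exact: measurable_kernel_integrand (measurable_heat t) mh.
Qed.

(** Expanding the free semigroup at x and at its mirror image by the method of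
    images, all terms agree except the image term, which has to be finite to be
    cancelled. *)
Lemma absorb_semigroup t s h x : 0 < t -> 0 < s -> v < x ->
  measurable_fun [set: R] h -> (forall y, (0 <= h y)%E) ->
  T (t + s) h (2 * v - x) \is a fin_num ->
  S t (S s h) x = S (t + s) h x.
Proof.
move=> t0 s0 vx mh h0 hfin.
pose rT y := T s h (2 * v - y).
have mT := measurable_heat_op s mh h0; have T0 := heat_op_ge0 s h0.
have mS := measurable_absorb_op s mh h0; have S0 := absorb_op_ge0 s h0.
have mrT : measurable_fun [set: R] rT by exact: measurable_reflect.
have rT0 y : (0 <= rT y)%E by exact: T0.
have split z : T (t + s) h z = (T t (T s h) z + T t rT (2 * v - z)%R)%E.
  by rewrite -(heat_semigroup z t0 s0 (measurable_itv `]v, +oo[) mh h0) (heat_op_fold t z mT T0).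
have image z : T t (T s h) z = (T t (S s h) z + T t rT z)%E.
  rewrite -kernel_opD//.
  - apply: eq_kernel_op => y; rewrite /= in_itv/= andbT => vy.
    exact: absorb_image.
  - exact: measurable_heat.
  - by move=> *; exact: heat_ge0.
have combine (X Y A A' B B' U U' W Z : \bar R) : X \is a fin_num ->
    Y = (A + B')%E -> X = (A' + B)%E -> A = (U + B)%E -> A' = (U' + B')%E ->
    U = (W + U')%E -> Y = (Z + X)%E -> W = Z.
  move=> Xfin YA XA AU AU' UW YZ.
  have E : (W + X = Z + X)%E.
    by rewrite -YZ YA XA AU AU' UW -!addeA; congr (_ + (_ + _))%E; rewrite addeC.
  by rewrite -(addeK W Xfin) E addeK.
have e2 := split (2 * v - x); rewrite subKr in e2.
exact: (combine _ _ _ _ _ _ _ _ _ _ hfin (split x) e2 (image x) (image _)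
  (absorb_image t vx mS S0) (absorb_image (t + s) vx mh h0)).
Qed.

End absorbed_heat.

(** * Exponential eigenfunctions *)

Section sinh_bounds.
Context {R : realType}.
Notation leb := (@lebesgue_measure R).
Notation mR := (measurableTypeR R).
Variable v : R.
Implicit Types (t s x y a b l : R) (h : R -> \bar R).
Notation V := (`]v, +oo[%classic : set mR).
Notation T t := (kernel_op (heat t) V).
Notation S t := (kernel_op (absorb v t) V).

Definition expat a y : R := expR (a * (y - v)).

(** Twice the hyperbolic sine of l |y - v|; the absolute value makes it
    nonnegative on both sides of the level. *)
Definition sinhat l y : R := expR (l * `|y - v|) - expR (- (l * `|y - v|)).

Lemma sinhat_ge0 l y : 0 <= l -> 0 <= sinhat l y.
Proof. by move=> l0; rewrite subr_ge0 ler_expR ge0_cp// mulr_ge0. Qed.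

Lemma sinhatE l y : v < y -> sinhat l y + expat (- l) y = expat l y.
Proof.
by move=> vy; rewrite /sinhat /expat gtr0_norm ?subr_gt0// mulNr subrK.
Qed.

Lemma measurable_expat a : measurable_fun [set: R] (EFin \o expat a).
Proof.
apply/measurable_EFinP; apply: measurableT_comp => //.
by apply: measurable_funM => //; exact: measurable_funB.
Qed.

Lemma measurable_sinhat l : measurable_fun [set: R] (EFin \o sinhat l).
Proof.
have mn : measurable_fun [set: R] (fun y : R => l * `|y - v|).
  apply: measurable_funM => //; apply: measurableT_comp => //.
  exact: measurable_funB.
apply/measurable_EFinP; apply: measurable_funB; apply: measurableT_comp => //.
exact: measurableT_comp.
Qed.

Let heat0 t A x : (forall y, A y -> 0 <= heat t x y).
Proof. by move=> ? _; exact: heat_ge0. Qed.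

Let absorb0 t A x : (forall y, A y -> 0 <= absorb v t x y).
Proof. by move=> ? _; exact: absorb_ge0. Qed.

Let expat0 a y : (0 <= (expat a y)%:E)%E.
Proof. by rewrite lee_fin expR_ge0. Qed.

Lemma heat_op_expatT t a x : 0 < t ->
  kernel_op (heat t) [set: R] (EFin \o expat a) x =
  (expR (a ^+ 2 * t / 2) * expat a x)%:E.
Proof.
move=> t0; rewrite /kernel_op.
transitivity (\int[leb]_y ((expR (a ^+ 2 * t / 2) * expat a x)%:E *
    (heat t (x + a * t) y)%:E))%E.
  apply: eq_integral => y _; rewrite -!EFinM; congr (_%:E).
  rewrite /expat !mulrBr !expRD [LHS]mulrA heat_tilt// expRD.
  by move: (expR _) (expR _) (expR _) (heat _ _ _) => *; ring.
rewrite ge0_integralZl_EFin ?mulr_ge0 ?expR_ge0//.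
- by rewrite integral_heat// mule1.
- by move=> y _; rewrite lee_fin heat_ge0.
- by apply/measurable_EFinP; exact: (measurableT_comp (measurable_heat t) (measurable_pair1 _)).
Qed.

Lemma heat_op_expat t a x : 0 < t ->
  (T t (EFin \o expat a) x + T t (EFin \o expat (- a)) (2 * v - x)%R =
   (expR (a ^+ 2 * t / 2) * expat a x)%:E)%E.
Proof.
move=> t0; rewrite -(heat_op_expatT a x t0).
rewrite (@heat_op_fold R v t _ x (measurable_expat a) (expat0 a)).
have -> // : (fun y => (EFin \o expat a) (2 * v - y)) = EFin \o expat (- a).
by apply/funext => y /=; congr (_%:E); rewrite /expat; congr expR; ring.
Qed.

Lemma heat_op_expat_le t a x : 0 < t ->
  (T t (EFin \o expat a) x <= (expR (a ^+ 2 * t / 2) * expat a x)%:E)%E.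
Proof.
move=> t0; rewrite -heat_op_expat// leeDl//.
by apply: heat_op_ge0 => y; exact: expat0.
Qed.

Lemma heat_op_expat_fin t a x : 0 < t -> T t (EFin \o expat a) x \is a fin_num.
Proof.
move=> t0; rewrite ge0_fin_numE; first exact: le_lt_trans (heat_op_expat_le _ _ t0) (ltry _).
by apply: heat_op_ge0 => y; exact: expat0.
Qed.

Lemma heat_op_sinhatD t l x : 0 <= l ->
  (T t (EFin \o sinhat l) x + T t (EFin \o expat (- l)) x =
   T t (EFin \o expat l) x)%E.
Proof.
move=> l0; rewrite -kernel_opD//.
- apply: eq_kernel_op => y; rewrite /= in_itv/= andbT => vy.
  by rewrite -EFinD sinhatE.
- exact: measurable_heat.
- exact: heat0.
- exact: measurable_sinhat.
- exact: measurable_expat.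
- by move=> y; rewrite lee_fin sinhat_ge0.
- exact: expat0.
Qed.

(** On the half-line [sinhat] is the difference of two exponentials, which the
    reflection exchanges; being odd about the level, this difference is an
    eigenfunction of the absorbed semigroup with the eigenvalue of the
    exponentials. *)
Lemma absorb_sinhat t l x : 0 < t -> 0 <= l -> v < x ->
  (S t (EFin \o sinhat l) x = (expR (l ^+ 2 * t / 2) * sinhat l x)%:E)%E.
Proof.
move=> t0 l0 vx.
have ms := measurable_sinhat l.
have s0 y : (0 <= (sinhat l y)%:E)%E by rewrite lee_fin sinhat_ge0.
have E1 := heat_op_expat l x t0.
have E2 := heat_op_expat (- l) x t0; rewrite opprK sqrrN in E2.
have D1 := heat_op_sinhatD t x l0.
have D2 := heat_op_sinhatD t (2 * v - x) l0.
have I := absorb_image t vx ms s0.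
have f1 := heat_op_expat_fin (- l) x t0.
have f2 := heat_op_expat_fin (- l) (2 * v - x) t0.
have f3 := heat_op_expat_fin l x t0.
have f4 := heat_op_expat_fin l (2 * v - x) t0.
have S0 : (0 <= S t (EFin \o sinhat l) x)%E by exact: absorb_op_ge0.
have T0 z : (0 <= T t (EFin \o sinhat l) z)%E by exact: heat_op_ge0.
have fs z : T t (EFin \o sinhat l) z \is a fin_num.
  rewrite ge0_fin_numE//; apply: le_lt_trans (ltry (fine (T t (EFin \o expat l) z))).
  rewrite fineK ?heat_op_expat_fin// -heat_op_sinhatD// leeDl//.
  by apply: heat_op_ge0 => y; exact: expat0.
have fS : S t (EFin \o sinhat l) x \is a fin_num.
  rewrite ge0_fin_numE//; apply: le_lt_trans (ltry (fine (T t (EFin \o sinhat l) x))).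
  by rewrite fineK// I leeDl.
move: (fs x) (fs (2 * v - x)) => f5 f6 {T0 S0}.
have := sinhatE l vx.
move: E1 E2 D1 D2 I f1 f2 f3 f4 f5 f6 fS.
move: (T _ _ _) (T _ _ _) (T _ _ _) (T _ _ _) (T _ _ _) (T _ _ _) (S _ _ _).
do 7![move=> [? | |] //].
rewrite -!EFinD => -[E1] [E2] [D1] [D2] [I] _ _ _ _ _ _ _ E.
by congr (_%:E); rewrite -(addrK (expat (- l) x) (sinhat l x)) E mulrBr; lra.
Qed.

(** Mass conservation: for x above the level, the two terms are the survival and
    the exit probability of one step of the killed walk. *)
Lemma heat_op1 t x : 0 < t -> (T t (cst 1) x + T t (cst 1) (2 * v - x)%R = 1)%E.
Proof.
move=> t0; rewrite -[RHS](integral_heat x t0).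
have <- := @heat_op_fold _ v t (cst 1%E) x (measurable_cst _) (fun=> lee01).
by apply: eq_integral => y _; rewrite mule1.
Qed.

End sinh_bounds.

(** * The heat walk killed at discrete times *)

Section killed_walk.
Context {R : realType}.
Notation leb := (@lebesgue_measure R).
Notation mR := (measurableTypeR R).
Variable v : R.
Implicit Types (t s x y a b d e l : R) (h : R -> \bar R).
Notation V := (`]v, +oo[%classic : set mR).
Notation T t := (kernel_op (heat t) V).
Notation S t := (kernel_op (absorb v t) V).
Notation sinhat := (sinhat v).
Notation expat := (expat v).

Let heat0 t A x : (forall y, A y -> 0 <= heat t x y).
Proof. by move=> ? _; exact: heat_ge0. Qed.

Let absorb0 t A x : (forall y, A y -> 0 <= absorb v t x y).
Proof. by move=> ? _; exact: absorb_ge0. Qed.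

Let sinhat_split l b e y : 0 <= l -> 0 <= b -> 0 <= e -> v < y ->
  sinhat l y <= sinhat l (v + e) + expR (- (b * e)) * expat (l + b) y.
Proof.
move=> l0 b0 e0 vy; rewrite /sinhat /expat (addrAC v) subrr add0r (ger0_norm e0).
rewrite gtr0_norm ?subr_gt0//; move: vy; rewrite -subr_gt0; move: (y - v) => z z0.
have [ze|ez] := leP z e.
  rewrite -[leLHS]addr0 lerD// ?mulr_ge0 ?expR_ge0//.
  by apply: lerB; rewrite ler_expR ?lerN2 ler_wpM2l.
rewrite -[leLHS]add0r lerD//.
  by rewrite subr_ge0 ler_expR ge0_cp ?mulr_ge0.
rewrite -expRD lerBlDr -[leLHS]addr0 lerD ?expR_ge0// ler_expR; nra.
Qed.

(** What the walk observed every t counts as alive although the path has been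
    absorbed, weighted by the distance to the level. The two terms on the right
    bound the overshoots below and above the height e. *)
Lemma heat_op_sinhat_reflect t l b e x : 0 < t -> 0 <= l -> 0 <= b -> 0 <= e ->
  v < x ->
  (T t (EFin \o sinhat l) (2 * v - x)%R <=
   (sinhat l (v + e))%:E * T t (cst 1) (2 * v - x)%R +
   (expR (- (b * e)) * expR ((l + b) ^+ 2 * t / 2))%:E)%E.
Proof.
move=> t0 l0 b0 e0 vx.
have c0 : 0 <= expR (- (b * e)) by exact: expR_ge0.
have s0 y : 0 <= sinhat l y by exact: sinhat_ge0.
pose f1 y : \bar R := ((sinhat l (v + e))%:E * cst 1 y)%E.
pose f2 y : \bar R := ((expR (- (b * e)))%:E * (expat (l + b) y)%:E)%E.
have mf1 : measurable_fun [set: R] f1 by exact: measurable_cst.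
have mf2 : measurable_fun [set: R] f2.
  by apply: measurable_funeM; exact: measurable_expat.
have f10 y : (0 <= f1 y)%E by rewrite mule_ge0// lee_fin.
have f20 y : (0 <= f2 y)%E by rewrite mule_ge0// lee_fin expR_ge0.
apply: (@le_trans _ _ (T t (f1 \+ f2)%E (2 * v - x))).
  apply: le_kernel_op => //.
  - exact: measurable_heat.
  - exact: heat0.
  - exact: measurable_sinhat.
  - by apply: emeasurable_funD; [exact: mf1|exact: mf2].
  - move=> y; rewrite /= in_itv/= andbT => vy.
    by rewrite /f1 /f2 mule1 -EFinM -EFinD lee_fin sinhat_split.
rewrite kernel_opD//; [|exact: measurable_heat|exact: heat0].
rewrite /f1 /f2 !kernel_opZ//; last 6 first.
- exact: measurable_heat.
- exact: heat0.
- exact: measurable_expat.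
- by move=> y; rewrite lee_fin expR_ge0.
- exact: measurable_heat.
- exact: heat0.
apply: leeD => //; rewrite EFinM; apply: lee_wpmul2l; first by rewrite lee_fin.
apply: le_trans (heat_op_expat_le _ _ _ t0) _.
rewrite lee_fin ler_piMr ?expR_ge0// -[leRHS]expR0 ler_expR.
rewrite mulr_ge0_le0 ?addr_ge0//; lra.
Qed.

Lemma absorb_le_heat_op t h1 h2 x : v < x ->
  measurable_fun [set: R] h1 -> measurable_fun [set: R] h2 ->
  (forall y, (0 <= h1 y)%E) -> (forall y, (0 <= h2 y)%E) ->
  (forall y, v < y -> (h1 y <= h2 y)%E) ->
  (S t h1 x <= T t h2 x)%E.
Proof.
move=> vx m1 m2 p1 p2 h12.
rewrite (absorb_image t vx m2 p2) -[leLHS]adde0.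
apply: leeD; last exact: heat_op_ge0.
apply: le_kernel_op => //; first exact: measurable_absorb.
  exact: absorb0.
by move=> y; rewrite /= in_itv/= andbT; exact: h12.
Qed.

Lemma heat_op_fin l C h t x : 0 <= C -> measurable_fun [set: R] h ->
  (forall y, (0 <= h y)%E) ->
  (forall y, v < y -> (h y <= (C * expat l y)%:E)%E) ->
  0 < t -> T t h x \is a fin_num.
Proof.
move=> C0 mh h0 hC t0; rewrite ge0_fin_numE ?heat_op_ge0//.
apply: (@le_lt_trans _ _ (C%:E * T t (EFin \o expat l) x)%E).
  rewrite -kernel_opZ//; last 4 first.
  - exact: measurable_heat.
  - exact: heat0.
  - exact: measurable_expat.
  - by move=> y; rewrite lee_fin expR_ge0.
  apply: le_kernel_op => //.
  - exact: measurable_heat.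
  - exact: heat0.
  - by apply: measurable_funeM; exact: measurable_expat.
  - by move=> y; rewrite /= in_itv/= andbT -EFinM; exact: hC.
by rewrite -(fineK (heat_op_expat_fin _ _ _ t0)) -EFinM ltry.
Qed.

Lemma sinhat_le_expat l y : 0 <= l -> v < y -> sinhat l y <= expat l y.
Proof. by move=> l0 vy; rewrite -sinhatE// lerDl expR_ge0. Qed.

Section dominated.
Variables (l C : R) (h : R -> \bar R).
Hypotheses (l0 : 0 <= l) (C0 : 0 <= C).
Hypotheses (mh : measurable_fun [set: R] h) (h0 : forall y, (0 <= h y)%E).
Hypothesis hC : forall y, v < y -> (h y <= (C * sinhat l y)%:E)%E.

Let sinhat0 y : (0 <= (sinhat l y)%:E)%E.
Proof. by rewrite lee_fin sinhat_ge0. Qed.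

Let mCsinhat : measurable_fun [set: R] (fun y => (C%:E * (sinhat l y)%:E)%E).
Proof. by apply: measurable_funeM; exact: measurable_sinhat. Qed.

Lemma heat_op_le_sinhat t x :
  (T t h x <= C%:E * T t (EFin \o sinhat l) x)%E.
Proof.
rewrite -kernel_opZ//; last 3 first.
- exact: measurable_heat.
- exact: heat0.
- exact: measurable_sinhat.
apply: le_kernel_op => //; first exact: measurable_heat.
  exact: heat0.
by move=> y; rewrite /= in_itv/= andbT -EFinM; exact: hC.
Qed.

Lemma absorb_le_sinhat t x : 0 < t -> v < x ->
  (S t h x <= (C * expR (l ^+ 2 * t / 2) * sinhat l x)%:E)%E.
Proof.
move=> t0 vx; rewrite -mulrA EFinM -absorb_sinhat// -kernel_opZ//; last 3 first.
- exact: measurable_absorb.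
- exact: absorb0.
- exact: measurable_sinhat.
apply: le_kernel_op => //; first exact: measurable_absorb.
  exact: absorb0.
by move=> y; rewrite /= in_itv/= andbT -EFinM; exact: hC.
Qed.

End dominated.

Section walk_lower_bound.
Variables (l C : R) (h : R -> \bar R).
Hypothesis C0 : 0 <= C.
Hypotheses (mh : measurable_fun [set: R] h) (h0 : forall y, (0 <= h y)%E).
Hypothesis hE : forall y, v < y -> (h y <= (C * expat l y)%:E)%E.

Let walk d n := iter n (T d) h.

Let walk_ge0 d n y : (0 <= walk d n y)%E.
Proof. by elim: n y => //= n IHn y; exact: heat_op_ge0. Qed.

Let measurable_walk d n : measurable_fun [set: R] (walk d n).
Proof. by elim: n => //= n IHn; exact: measurable_heat_op. Qed.

(** Killing the path at discrete times only is more lenient than absorbing it. *)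
Lemma absorb_le_walk d n x : 0 < d -> v < x ->
  (S (n.+1%:R * d) h x <= walk d n.+1 x)%E.
Proof.
move=> d0; elim: n x => [|n IHn] x vx.
  by rewrite mul1r; exact: absorb_le_heat_op.
rewrite -[n.+2]add1n natrD mulrDl mul1r -absorb_semigroup ?mulr_gt0//.
  apply: absorb_le_heat_op => //.
  - exact: measurable_absorb_op.
  - exact: (measurable_walk d n.+1).
  - exact: absorb_op_ge0.
  - exact: (walk_ge0 d n.+1).
by apply: (heat_op_fin _ C0 mh h0 hE); rewrite addr_gt0 ?mulr_gt0.
Qed.

End walk_lower_bound.

Section walk.
Variables (l C : R) (h : R -> \bar R).
Hypotheses (l0 : 0 <= l) (C0 : 0 <= C).
Hypotheses (mh : measurable_fun [set: R] h) (h0 : forall y, (0 <= h y)%E).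
Hypothesis hC : forall y, v < y -> (h y <= (C * sinhat l y)%:E)%E.

Let hE y : v < y -> (h y <= (C * expat l y)%:E)%E.
Proof.
move=> vy; apply: le_trans (hC vy) _.
by rewrite lee_fin ler_wpM2l// sinhat_le_expat.
Qed.

Let walk d n := iter n (T d) h.

Let walk_ge0 d n y : (0 <= walk d n y)%E.
Proof. by elim: n y => //= n IHn y; exact: heat_op_ge0. Qed.

Let measurable_walk d n : measurable_fun [set: R] (walk d n).
Proof. by elim: n => //= n IHn; exact: measurable_heat_op. Qed.

(** Each step adds to the discrepancy at most a multiple of the weighted mass that
    [heat_op_sinhat_reflect] bounds. The part of that bound which is
    proportional to the exit probability does not accumulate over the steps,
    because the walk exits at most once; in the induction this is the identity
    that the one-step survival and exit probabilities add up to 1. *)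
Lemma walk_le_absorb d n b e x : 0 < d -> 0 <= b -> 0 <= e -> v < x ->
  (walk d n.+1 x <= S (n.+1%:R * d) h x +
    (C * expR (l ^+ 2 * (n%:R * d) / 2) * (sinhat l (v + e) +
     n.+1%:R * (expR (- (b * e)) * expR ((l + b) ^+ 2 * d / 2))))%:E)%E.
Proof.
move=> d0 b0 e0; set s := sinhat l (v + e).
set k := expR (- (b * e)) * expR _.
have s0 : 0 <= s by exact: sinhat_ge0.
have k0 : 0 <= k by rewrite mulr_ge0 ?expR_ge0.
have refl z : v < z -> (T d (EFin \o sinhat l) (2 * v - z)%R <=
    s%:E * T d (cst 1) (2 * v - z)%R + k%:E)%E.
  by move=> vz; exact: heat_op_sinhat_reflect.
have refl_h (g : R -> \bar R) (D : R) z : v < z -> 0 <= D ->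
    measurable_fun [set: R] g -> (forall y, 0 <= g y)%E ->
    (forall y, v < y -> (g y <= (D * sinhat l y)%:E)%E) ->
    (T d g (2 * v - z)%R <= D%:E * (s%:E * T d (cst 1) (2 * v - z)%R + k%:E))%E.
  move=> vz D0 mg g0 gD.
  apply: le_trans (heat_op_le_sinhat l0 D0 mg g0 gD _ _) _.
  by apply: lee_wpmul2l; rewrite ?lee_fin// refl.
have one y : (0 <= cst 1%E y :> \bar R)%E by [].
have T1 z := heat_op_ge0 v d one z.
elim: n x => [|n IHn] x vx.
  rewrite mul0r mulr0 mul0r expR0 mulr1 !mul1r /= (absorb_image d vx mh h0).
  rewrite leeD2l//; apply: le_trans (refl_h _ _ _ vx C0 mh h0 hC) _.
  rewrite [leRHS]EFinM; apply: lee_wpmul2l; first by rewrite lee_fin.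
  rewrite [leRHS]EFinD leeD2r// -[leRHS]mule1.
  apply: lee_wpmul2l; first by rewrite lee_fin.
  by rewrite -[leRHS](heat_op1 v x d0) leeDr.
set c := C * expR (l ^+ 2 * (n.+1%:R * d) / 2).
have c0 : 0 <= c by rewrite mulr_ge0 ?expR_ge0.
pose K := c * (s + n.+1%:R * k).
have K0 : 0 <= K by rewrite mulr_ge0// addr_ge0// mulr_ge0.
pose g := S (n.+1%:R * d) h.
have mg : measurable_fun [set: R] g by exact: measurable_absorb_op.
have g0 y : (0 <= g y)%E by exact: absorb_op_ge0.
have gC y : v < y -> (g y <= (c * sinhat l y)%:E)%E.
  by move=> vy; apply: (absorb_le_sinhat l0 C0 mh h0 hC) => //; rewrite mulr_gt0.
have semig : S d g x = S (n.+2%:R * d) h x.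
  have -> : n.+2%:R * d = d + n.+1%:R * d by rewrite -[n.+2]add1n natrD mulrDl mul1r.
  apply: absorb_semigroup => //; first by rewrite mulr_gt0.
  by apply: (heat_op_fin _ C0 mh h0 hE); rewrite addr_gt0 ?mulr_gt0.
rewrite -semig.
apply: (@le_trans _ _ (T d (g \+ (fun y => K%:E * cst 1 y))%E x)).
  apply: le_kernel_op => //.
  - exact: measurable_heat.
  - exact: heat0.
  - exact: (measurable_walk d n.+1).
  - exact: emeasurable_funD.
  - exact: (walk_ge0 d n.+1).
  - move=> y; rewrite /= in_itv/= andbT => vy; rewrite mule1.
    apply: le_trans (IHn _ vy) _; apply: leeD => //; rewrite lee_fin /K.
    have cc : C * expR (l ^+ 2 * (n%:R * d) / 2) <= c.
      apply: ler_wpM2l => //; rewrite ler_expR; apply: ler_wpM2r => //.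
      apply: ler_wpM2l; first exact: sqr_ge0.
      by apply: ler_wpM2r; [exact: ltW|rewrite ler_nat].
    by apply: ler_wpM2r => //; rewrite addr_ge0// mulr_ge0.
rewrite kernel_opD//; last 3 first.
- exact: measurable_heat.
- exact: heat0.
- by move=> y; rewrite mule1 lee_fin.
rewrite kernel_opZ//; [|exact: measurable_heat|exact: heat0].
rewrite (absorb_image d vx mg g0) -addeA leeD2l//.
apply: (@le_trans _ _ (c%:E * (s%:E * T d (cst 1) (2 * v - x)%R + k%:E) +
    K%:E * T d (cst 1) x)%E).
  by rewrite leeD2r//; exact: refl_h.
have := heat_op1 v x d0; have := T1 x; have := T1 (2 * v - x).
move: (T _ _ _) (T _ _ _) => [p| |] [q| |] //=.
rewrite !lee_fin -EFinD => p0 q0 [pq].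
rewrite -?EFinM -?EFinD -?EFinM -?EFinD ?lee_fin.
rewrite /K -[n.+2]add1n natrD -(mulrA c) -(mulrDr c); apply: ler_wpM2l => //.
have nk0 : 0 <= n.+1%:R * k by rewrite mulr_ge0.
have p1 : p <= 1 by rewrite -pq lerDl.
have -> : q = 1 - p by rewrite -pq addrAC subrr add0r.
rewrite (mulrDl 1%:R) mul1r; move: (n.+1%:R * k) nk0 => nk nk0.
have := ler_piMr nk0 p1; lra.
Qed.

End walk.

End killed_walk.

(** * Convergence of the killed walk to the absorbed semigroup *)

Section refinement_limit.
Context {R : realType}.
Notation mR := (measurableTypeR R).
Variable v : R.
Implicit Types (t s x y a b d e l : R) (h : R -> \bar R).
Notation V := (`]v, +oo[%classic : set mR).
Notation T t := (kernel_op (heat t) V).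
Notation S t := (kernel_op (absorb v t) V).

Let sinhat_small l (D : R) e0 : 0 <= l -> 0 <= D -> 0 < e0 ->
  exists2 e, 0 < e & D * sinhat v l (v + e) <= e0.
Proof.
move=> l0 D0 e00.
have l1 : 0 < l + 1 by rewrite ltr_wpDl.
pose q := 2 * (l + 1) + 3 * (l + 1) * D / e0.
have q1 : 2 * (l + 1) <= q by rewrite lerDl divr_ge0 ?mulr_ge0// ltW.
have q2 : 3 * (l + 1) * D / e0 <= q by rewrite lerDr mulr_ge0// ltW.
have q0 : 0 < q by rewrite (lt_le_trans _ q1)// mulr_gt0.
exists q^-1; first by rewrite invr_gt0.
rewrite /sinhat (addrAC v) subrr add0r gtr0_norm ?invr_gt0//.
set z := l * q^-1.
have z0 : 0 <= z by rewrite divr_ge0// ltW.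
have z2 : z <= 2^-1.
  by rewrite /z ler_pdivrMr//; move: q1; lra.
have ez : expR z - expR (- z) <= 3 * z.
  have h1 := expR_ge1Dx (- z).
  have h2 : expR z * expR (- z) = 1 by rewrite -expRD subrr expR0.
  have := expR_gt0 z; move: (expR z) (expR (- z)) h1 h2 => A B h1 h2 A0.
  suff : A <= 1 + 2 * z by lra.
  by nra.
apply: (@le_trans _ _ (D * (3 * z))); first exact: ler_wpM2l.
rewrite /z !mulrA ler_pdivrMr//.
have : 3 * (l + 1) * D <= q * e0 by rewrite -ler_pdivrMr.
have : 0 <= D * 3 by rewrite mulr_ge0.
nra.
Qed.

Let exp_decay e x : 0 < e -> 0 < x -> x ^+ 2 * expR (- (x * e)) <= 27 / (e ^+ 3 * x).
Proof.
move=> e0 x0.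
have y0 : 0 <= x * e / 3 by rewrite divr_ge0// mulr_ge0 ?ltW.
have h1 : x * e / 3 <= expR (x * e / 3).
  by apply: le_trans (expR_ge1Dx _); rewrite lerDr.
have h3 : (x * e / 3) ^+ 3 <= expR (x * e).
  rewrite (_ : expR (x * e) = expR (x * e / 3) ^+ 3).
    by rewrite lerXn2r// nnegrE expR_ge0.
  by rewrite -expRM_natl; congr expR; field.
rewrite expRN ler_pdivrMr ?expR_gt0// mulrAC ler_pdivlMr; last first.
  by rewrite mulr_gt0 ?exprn_gt0.
have -> : x ^+ 2 * (e ^+ 3 * x) = 27 * (x * e / 3) ^+ 3 by field.
by rewrite ler_pM2l.
Qed.

(** In [walk_le_absorb] with 4 ^ m steps take b = 2 ^ m: then (l + b) ^ 2 times the
    length of a step is bounded, while expR (- (b * e)) beats the number of steps.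
    This deals with the overshoots above any fixed height e, and a small e deals
    with the others. The estimate is uniform in h and x, as the iteration over
    several intervals requires. *)
Lemma walk_cvg_absorb t l (C : R) e0 : 0 < t -> 0 <= l -> 0 <= C -> 0 < e0 ->
  exists m0, forall m, (m0 <= m)%N -> forall h x, v < x ->
    measurable_fun [set: R] h -> (forall y, 0 <= h y)%E ->
    (forall y, v < y -> (h y <= (C * sinhat v l y)%:E)%E) ->
    (iter (4 ^ m) (T (t / (4 ^ m)%:R)) h x <= S t h x + e0%:E)%E.
Proof.
move=> t0 l0 C0 e00.
pose D := C * expR (l ^+ 2 * t / 2).
have D0 : 0 <= D by rewrite mulr_ge0 ?expR_ge0.
pose E := expR ((l + 1) ^+ 2 * t / 2).
have E0 : 0 < E by exact: expR_gt0.
have e20 : 0 < e0 / 2 by rewrite divr_gt0.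
have [e ep He] := sinhat_small l0 D0 e20.
pose q := D * E * (27 / e ^+ 3) / (e0 / 2).
exists (Num.truncn q).+1 => m m0m h x vx mh h0 hC.
have N0 : (0 < 4 ^ m)%N by rewrite expn_gt0.
set d := t / (4 ^ m)%:R.
have d0 : 0 < d by rewrite divr_gt0// ltr0n.
pose b : R := (2 ^ m)%:R.
have b1 : 1 <= b by rewrite ler1n expn_gt0.
have b0 : 0 < b by rewrite (lt_le_trans _ b1).
have bN : (4 ^ m)%:R = b ^+ 2 :> R by rewrite -natrX -expnM mulnC expnM.
have qb : q <= b.
  apply: ltW; apply: (lt_le_trans (truncnS_gt q)); rewrite ler_nat.
  exact/(leq_trans m0m)/ltnW/ltn_expl.
have Nd : (4 ^ m)%:R * d = t by rewrite /d mulrC divfK// pnatr_eq0 -lt0n.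
have := walk_le_absorb l0 C0 mh h0 hC (4 ^ m).-1 d0 (ltW b0) (ltW ep) vx.
rewrite prednK// Nd => /le_trans; apply; apply: leeD => //; rewrite lee_fin.
have -> : e0 = e0 / 2 + e0 / 2 by lra.
have Ele : expR ((l + b) ^+ 2 * d / 2) <= E.
  rewrite ler_expR /d bN ler_pM2r//.
  rewrite mulrA mulrAC ler_pM2r// ler_pdivrMr ?exprn_gt0// -exprMn.
  have lb : l + b <= (l + 1) * b by nra.
  have lb0 : 0 <= l + b by rewrite addr_ge0// ltW.
  by rewrite lerXn2r// nnegrE (le_trans lb0).
apply: (@le_trans _ _ (D * (sinhat v l (v + e) +
    b ^+ 2 * (expR (- (b * e)) * E)))).
  rewrite bN; apply: ler_pM.
  - by rewrite mulr_ge0 ?expR_ge0.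
  - by rewrite addr_ge0 ?sinhat_ge0// !mulr_ge0 ?expR_ge0 ?sqr_ge0.
  - apply: ler_wpM2l => //; rewrite ler_expR ler_pM2r//.
    apply: ler_wpM2l; first exact: sqr_ge0.
    by rewrite -Nd; apply: ler_wpM2r; [exact: ltW|rewrite ler_nat leq_pred].
  - rewrite lerD2l; apply: ler_wpM2l; first exact: sqr_ge0.
    by apply: ler_wpM2l; rewrite ?expR_ge0.
rewrite mulrDr lerD//.
apply: (@le_trans _ _ (D * E * (27 / (e ^+ 3 * b)))).
  have -> : D * (b ^+ 2 * (expR (- (b * e)) * E)) =
      D * E * (b ^+ 2 * expR (- (b * e))).
    by move: (expR _) => z; ring.
  apply: ler_wpM2l; last exact: exp_decay.
  by rewrite mulr_ge0// ltW.
move: qb; rewrite /q ler_pdivrMr// => qb.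
have -> : D * E * (27 / (e ^+ 3 * b)) = D * E * (27 / e ^+ 3) / b.
  by field; rewrite ?lt0r_neq0.
by rewrite ler_pdivrMr// (mulrC (e0 / 2)).
Qed.

End refinement_limit.

(** * Chains of refined steps *)

Section refined_chains.
Context {R : realType}.
Notation leb := (@lebesgue_measure R).
Notation mR := (measurableTypeR R).
Variable v : R.
Implicit Types (t s x y a b d e l : R) (h : R -> \bar R)
  (A : set mR) (L : seq (R * set mR)).
Notation V := (`]v, +oo[%classic : set mR).
Notation T t := (kernel_op (heat t) V).
Notation S t := (kernel_op (absorb v t) V).

(** Each step is cut into 4 ^ m equal steps that are all required to stay above
    the level. The number of pieces is a perfect square because the overshoot
    is estimated with an exponential rate equal to its square root. *)
Definition refine m L : seq (R * set mR) :=
  flatten [seq rcons (nseq (4 ^ m).-1 (p.1 / (4 ^ m)%:R, V))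
                     (p.1 / (4 ^ m)%:R, V `&` p.2) | p <- L].

Lemma kernel_op_restrict k A B h x :
  kernel_op k (B `&` A) h x = kernel_op k B (h \_ A) x.
Proof.
rewrite /kernel_op integral_mkcondr; apply: eq_integral => y _.
by rewrite /patch; case: ifP; rewrite ?mule0.
Qed.

Lemma absorb_op_restrict t A h x :
  kernel_op (absorb v t) A h x = S t (h \_ A) x.
Proof.
rewrite -kernel_op_restrict /kernel_op integral_mkcond [RHS]integral_mkcond.
apply: eq_integral => y _; rewrite /patch in_setI.
case: (boolP (y \in A)) => yA; rewrite ?andbF// andbT.
case: ifPn => //; rewrite mem_setE in_itv/= andbT => vy.
by rewrite /absorb (negbTE vy) andbF mul0e.
Qed.

Lemma chain_refine_cons m p L h :
  chain heat (refine m (p :: L)) h =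
  iter (4 ^ m) (T (p.1 / (4 ^ m)%:R)) (chain heat (refine m L) h \_ p.2).
Proof.
rewrite /refine /= chain_cat -/(refine m L) -cats1 chain_cat /=.
move: (chain heat (refine m L) h) => g.
set d := p.1 / _.
have -> : (4 ^ m)%N = (4 ^ m).-1.+1 by rewrite prednK// expn_gt0.
rewrite iterSr /=.
have -> : kernel_op (heat d) (V `&` p.2) g = T d (g \_ p.2).
  by apply/funext => x; exact: kernel_op_restrict.
by elim: (4 ^ m).-1 => //= n ->.
Qed.

Lemma measurable_steps_refine m L :
  measurable_steps L -> measurable_steps (refine m L).
Proof.
elim: L => [|p L IHL] /=; first by move=> _ q; rewrite in_nil.
move=> /measurable_steps_cons[mp mL] q.
rewrite /refine /= mem_cat mem_rcons in_cons mem_nseq -orbA.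
case/or3P => [/eqP ->/=|/andP[_ /eqP ->]//=|]; last exact: IHL.
exact: measurableI.
Qed.

Lemma measurable_patch A h : measurable A -> measurable_fun [set: R] h ->
  measurable_fun [set: R] (h \_ A).
Proof.
by move=> mA mh; apply/(measurable_restrictT _ _).1 => //; exact: measurable_funTS.
Qed.

Let iter_heat_ge0 d n h x : (forall y, 0 <= h y)%E -> (0 <= iter n (T d) h x)%E.
Proof. by move=> h0; elim: n x => //= n IHn x; exact: heat_op_ge0. Qed.

Let measurable_iter_heat d n h : measurable_fun [set: R] h ->
  (forall y, 0 <= h y)%E -> measurable_fun [set: R] (iter n (T d) h).
Proof.
move=> mh h0; elim: n => //= n IHn; apply: measurable_heat_op => // y.
exact: iter_heat_ge0.
Qed.

Lemma heat_op_cst_le t (c : R) x : 0 < t -> 0 <= c ->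
  (T t (fun=> c%:E) x <= c%:E)%E.
Proof.
move=> t0 c0.
have -> : (fun=> c%:E) = (fun y : R => (c%:E * cst 1 y)%E).
  by apply/funext => y; rewrite mule1.
rewrite kernel_opZ//; last 2 first.
- exact: measurable_heat.
- by move=> y _; exact: heat_ge0.
rewrite -[leRHS]mule1; apply: lee_wpmul2l; first by rewrite lee_fin.
by rewrite -[leRHS](heat_op1 v x t0) leeDl// heat_op_ge0.
Qed.

Let iter_heat_le d n (h1 h2 : R -> \bar R) (c : R) : 0 < d -> 0 <= c ->
  measurable_fun [set: R] h1 -> measurable_fun [set: R] h2 ->
  (forall y, 0 <= h1 y)%E -> (forall y, 0 <= h2 y)%E ->
  (forall y, v < y -> (h1 y <= h2 y + c%:E)%E) ->
  forall y, v < y -> (iter n (T d) h1 y <= iter n (T d) h2 y + c%:E)%E.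
Proof.
move=> d0 c0 m1 m2 p1 p2 h12; elim: n => // n IHn x vx /=.
have mi2 := measurable_iter_heat d n m2 p2.
have i20 y := iter_heat_ge0 d n y p2.
apply: (@le_trans _ _ (T d (iter n (T d) h2 \+ cst c%:E)%E x)).
  apply: le_kernel_op => //.
  - exact: measurable_heat.
  - by move=> y _; exact: heat_ge0.
  - exact: measurable_iter_heat.
  - by apply: emeasurable_funD => //; exact: measurable_cst.
  - by move=> y; exact: iter_heat_ge0.
  - by move=> y; rewrite /= in_itv/= andbT; exact: IHn.
rewrite kernel_opD//; last 2 first.
- exact: measurable_heat.
- by move=> y _; exact: heat_ge0.
by apply: leeD => //; exact: heat_op_cst_le.
Qed.

Section dominated_chain.
Variables (l K : R) (h : R -> \bar R).
Hypotheses (l0 : 0 < l) (K0 : 0 <= K).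
Hypotheses (mh : measurable_fun [set: R] h) (h0 : forall y, (0 <= h y)%E).
Hypothesis hK : forall y, v < y -> (h y <= (K * expat v l y)%:E)%E.

Let chain0 L x : (0 <= chain (absorb v) L h x)%E.
Proof. by apply: chain_ge0 => // t a b; exact: absorb_ge0. Qed.

Let mchain L : measurable_steps L ->
  measurable_fun [set: R] (chain (absorb v) L h).
Proof.
move=> mL; apply: measurable_chain => //; first exact: measurable_absorb.
by move=> t x y; exact: absorb_ge0.
Qed.

Let hchain0 m L x : (0 <= chain heat (refine m L) h x)%E.
Proof. by apply: chain_ge0 => // t a b; exact: heat_ge0. Qed.

Let mhchain m L : measurable_steps L ->
  measurable_fun [set: R] (chain heat (refine m L) h).
Proof.
move=> mL; apply: measurable_chain => //; first exact: measurable_heat.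
  by move=> t x y; exact: heat_ge0.
exact: measurable_steps_refine.
Qed.

Lemma patch_le (f : R -> \bar R) A y : (0 <= f y)%E -> ((f \_ A) y <= f y)%E.
Proof. by rewrite /patch; case: ifP. Qed.

Lemma patch_ge0 (f : R -> \bar R) A : (forall y, 0 <= f y)%E ->
  forall y, (0 <= (f \_ A) y)%E.
Proof. by move=> f0 y; rewrite /patch; case: ifP. Qed.

Lemma absorb_chain_le L : measurable_steps L -> (forall p, p \in L -> 0 < p.1) ->
  exists2 K', 0 <= K' &
    forall x, v < x -> (chain (absorb v) L h x <= (K' * expat v l x)%:E)%E.
Proof.
elim: L => [|p L IHL] mL pL; first by exists K.
have [mp mL'] := measurable_steps_cons mL.
have [q qL|K' K'0 IH] := IHL mL'; first by apply: pL; rewrite in_cons qL orbT.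
have p0 : 0 < p.1 by apply: pL; rewrite in_cons eqxx.
exists (K' * expR (l ^+ 2 * p.1 / 2)); first by rewrite mulr_ge0 ?expR_ge0.
move=> x vx /=; rewrite absorb_op_restrict.
have mK : measurable_fun [set: R] (fun y => (K'%:E * (expat v l y)%:E)%E).
  by apply: measurable_funeM; exact: measurable_expat.
have K0' y : (0 <= K'%:E * (expat v l y)%:E)%E.
  by rewrite mule_ge0// lee_fin// expR_ge0.
apply: (@le_trans _ _ (T p.1 (fun y => K'%:E * (expat v l y)%:E)%E x)).
  apply: absorb_le_heat_op => //.
  - by apply: measurable_patch => //; exact: mchain.
  - exact: patch_ge0.
  - by move=> y vy; rewrite -EFinM; apply: le_trans (IH _ vy); exact: patch_le.
rewrite kernel_opZ//; last 4 first.
- exact: measurable_heat.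
- by move=> y _; exact: heat_ge0.
- exact: measurable_expat.
- by move=> y; rewrite lee_fin expR_ge0.
rewrite -mulrA EFinM; apply: lee_wpmul2l; first by rewrite lee_fin.
exact: heat_op_expat_le.
Qed.

Lemma absorb_chain_le_refine m L x : measurable_steps L ->
  (forall p, p \in L -> 0 < p.1) -> v < x ->
  (chain (absorb v) L h x <= chain heat (refine m L) h x)%E.
Proof.
elim: L x => // p L IHL x mL pL vx.
have [mp mL'] := measurable_steps_cons mL.
have p0 : 0 < p.1 by apply: pL; rewrite in_cons eqxx.
have pL' q : q \in L -> 0 < q.1 by move=> qL; apply: pL; rewrite in_cons qL orbT.
have [K' K'0 HK'] := absorb_chain_le mL' pL'.
rewrite chain_refine_cons /= absorb_op_restrict.
set d := p.1 / _; have d0 : 0 < d by rewrite divr_gt0// ltr0n expn_gt0.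
set g := chain (absorb v) L h \_ p.2.
have mg : measurable_fun [set: R] g by apply: measurable_patch => //; exact: mchain.
have g0 y : (0 <= g y)%E by exact: patch_ge0.
have gK y : v < y -> (g y <= (K' * expat v l y)%:E)%E.
  by move=> vy; apply: le_trans (HK' _ vy); exact: patch_le.
have := absorb_le_walk K'0 mg g0 gK (4 ^ m).-1 d0 vx.
rewrite prednK ?expn_gt0// {1}/d mulrC divfK ?pnatr_eq0 -?lt0n ?expn_gt0//.
move/le_trans; apply.
rewrite -[leRHS]adde0; apply: iter_heat_le => //.
- by apply: measurable_patch => //; exact: mhchain.
- exact: patch_ge0.
- move=> y vy; rewrite adde0 /g /patch; case: ifP => // _.
  exact: IHL.
Qed.

(** The gap eta between the targets and the level makes the function to be
    transported at each step comparable with [sinhat], so that the estimate for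
    one interval applies. The errors add up over the steps, because the killed
    heat operators do not increase constants. *)
Lemma refine_le_absorb_chain (eta : R) L e : 0 < eta -> 0 < e ->
  measurable_steps L -> (forall p, p \in L -> 0 < p.1) ->
  (forall p, p \in L -> forall y, p.2 y -> v + eta < y) ->
  exists m0, forall m, (m0 <= m)%N -> forall x, v < x ->
    (chain heat (refine m L) h x <= chain (absorb v) L h x + e%:E)%E.
Proof.
move=> eta0; elim: L e => [|p L IHL] e e0 mL pL gL.
  by exists 0%N => m _ x vx /=; rewrite leeDl// lee_fin ltW.
have [mp mL'] := measurable_steps_cons mL.
have p0 : 0 < p.1 by apply: pL; rewrite in_cons eqxx.
have pL' q : q \in L -> 0 < q.1 by move=> qL; apply: pL; rewrite in_cons qL orbT.
have gL' q : q \in L -> forall y, q.2 y -> v + eta < y.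
  by move=> qL; apply: gL; rewrite in_cons qL orbT.
have e20 : 0 < e / 2 by rewrite divr_gt0.
have [m1 Hm1] := IHL _ e20 mL' pL' gL'.
have [K' K'0 HK'] := absorb_chain_le mL' pL'.
(* beyond the gap the exponential is at most sinhat / r *)
pose r := 1 - expR (- (2 * l * eta)).
have r0 : 0 < r by rewrite subr_gt0 -[ltRHS]expR0 ltr_expR oppr_lt0 !mulr_gt0.
have C0 : 0 <= K' / r by rewrite divr_ge0// ltW.
have [m2 Hm2] := walk_cvg_absorb v p0 (ltW l0) C0 e20.
exists (maxn m1 m2) => m; rewrite geq_max => /andP[m1m m2m] x vx.
rewrite chain_refine_cons /= absorb_op_restrict.
set d := p.1 / _; have d0 : 0 < d by rewrite divr_gt0// ltr0n expn_gt0.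
set g := chain (absorb v) L h \_ p.2.
have mg : measurable_fun [set: R] g by apply: measurable_patch => //; exact: mchain.
have g0 y : (0 <= g y)%E by exact: patch_ge0.
have gC y : v < y -> (g y <= (K' / r * sinhat v l y)%:E)%E.
  move=> vy; rewrite /g /patch; case: ifPn => [/set_mem py|_]; last first.
    by rewrite lee_fin mulr_ge0// sinhat_ge0// ltW.
  apply: le_trans (HK' _ vy) _; rewrite lee_fin -mulrA ler_wpM2l//.
  rewrite mulrC ler_pdivlMr//.
  have vey := gL _ (mem_head _ _) _ py.
  have -> : sinhat v l y = expat v l y * (1 - expR (- (2 * l * (y - v)))).
    rewrite -(addrK (expat v (- l) y) (sinhat v l y)) sinhatE//.
    rewrite mulrBr mulr1; congr (_ - _).
    by rewrite /expat -expRD; congr expR; ring.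
  rewrite ler_wpM2l ?expR_ge0// lerD2l lerN2 ler_expR lerN2.
  by rewrite ler_pM2l ?mulr_gt0//; lra.
have -> : (e%:E = (e / 2)%:E + (e / 2)%:E)%E by rewrite -EFinD; congr EFin; lra.
rewrite addeA; apply: (@le_trans _ _ (iter (4 ^ m) (T d) g x + (e / 2)%:E)%E).
  apply: iter_heat_le => //; first exact: ltW.
  - by apply: measurable_patch => //; exact: mhchain.
  - exact: patch_ge0.
  - move=> y vy; rewrite /g /patch; case: ifP => _; last first.
      by rewrite add0e lee_fin ltW.
    exact: Hm1.
by apply: leeD => //; exact: Hm2.
Qed.

End dominated_chain.

End refined_chains.

(** * Drift, and levels decreasing to v *)

Section drift.
Context {R : realType}.
Notation leb := (@lebesgue_measure R).
Notation mR := (measurableTypeR R).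
Variable mu : R.
Implicit Types (v t s x y a b d e l : R) (h : R -> \bar R)
  (A : set mR) (L : seq (R * set mR)).

(** The Cameron-Martin likelihood ratio of the drift over one step. It is
    multiplicative along a chain, where only the two ends and the total duration
    survive. *)
Definition tilt t x y : R := expR (mu * (y - x) - mu ^+ 2 * t / 2).

Definition tilted (k : R -> R -> R -> R) t x y : R := tilt t x y * k t x y.

Lemma drifted_heatE t x y : 0 < t -> heat t (x + mu * t) y = tilted heat t x y.
Proof.
move=> t0; rewrite /tilted /tilt.
rewrite (_ : mu * (y - x) - mu ^+ 2 * t / 2 =
  - (mu * x + mu ^+ 2 * t / 2) + mu * y); last by ring.
by rewrite expRD -mulrA (mulrC (expR (mu * y))) heat_tilt// mulrA -expRD addNr expR0 mul1r.
Qed.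

Lemma drifted_killed_kernelE v t x y : 0 < t ->
  drifted_killed_kernel mu v t x y = tilt t x y * killed_kernel v t x y.
Proof.
move=> t0; rewrite /drifted_killed_kernel /tilt /killed_kernel.
rewrite [in RHS]mulrA [in RHS]mulrBr [in RHS]mulrBl.
rewrite (mulrA (expR (- (2 * mu * _)))) -!expRD.
by congr (expR _ / _ - expR _ / _); field; rewrite gt_eqF.
Qed.

Lemma tilt_gt0 t x y : 0 < tilt t x y.
Proof. exact: expR_gt0. Qed.

Lemma tiltM t s x y z : tilt t x y * tilt s y z = tilt (t + s) x z.
Proof. by rewrite /tilt -expRD; congr expR; ring. Qed.

Definition duration L : R := \sum_(p <- L) p.1.

Definition endpoint_tilt y : \bar R := (expR (mu * y))%:E.

Lemma measurable_endpoint_tilt : measurable_fun [set: R] endpoint_tilt.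
Proof. by apply/measurable_EFinP; apply: measurableT_comp => //; exact: measurable_funM. Qed.

Lemma endpoint_tilt_ge0 y : (0 <= endpoint_tilt y)%E.
Proof. by rewrite lee_fin expR_ge0. Qed.

Lemma chain_tilted (k : R -> R -> R -> R) L x :
  (forall t, jointly_measurable (k t)) -> (forall t x y, 0 <= k t x y) ->
  measurable_steps L ->
  chain (tilted k) L (cst 1%E) x =
  ((expR (- (mu * x + mu ^+ 2 * duration L / 2)))%:E *
   chain k L endpoint_tilt x)%E.
Proof.
move=> mk k0; elim: L x => [|p L IHL] x mL /=.
  rewrite /duration big_nil mulr0 mul0r addr0 -EFinM -expRD addrC subrr.
  by rewrite expR0.
have [mp mL'] := measurable_steps_cons mL.
rewrite /kernel_op -ge0_integralZl_EFin ?expR_ge0//; last 2 first.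
- by move=> y _; rewrite mule_ge0 ?lee_fin// chain_ge0// => z; exact: endpoint_tilt_ge0.
- apply: measurable_kernel_integrand => //.
  apply: measurable_chain => //; first exact: measurable_endpoint_tilt.
  exact: endpoint_tilt_ge0.
apply: eq_integral => y _; rewrite IHL// !muleA -!EFinM; congr (_%:E * _)%E.
rewrite /tilted /tilt mulrAC -expRD; congr (expR _ * _).
by rewrite /duration big_cons; ring.
Qed.

End drift.

(** A path stays above v up to a given time exactly when it stays above one of
    countably many levels that decrease to v. *)
Section level_limit.
Context {R : realType}.
Notation leb := (@lebesgue_measure R).
Notation mR := (measurableTypeR R).
Implicit Types (v t s x y a b d e l : R) (h : R -> \bar R)
  (A : set mR) (L : seq (R * set mR)).

Lemma absorb_nonincreasing v w t x y : v <= w -> 0 < t ->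
  absorb w t x y <= absorb v t x y.
Proof.
move=> vw t0; rewrite {1}/absorb; case: ifP => [/andP[wx wy]|_]; last first.
  exact: absorb_ge0.
rewrite absorbE ?(le_lt_trans vw)// /killed_kernel.
rewrite ler_wpM2r ?invr_ge0// lerD2l lerN2 ler_expR lerN2.
rewrite ler_pM2r ?invr_gt0 ?mulr_gt0//; nra.
Qed.

Variable v : R.

Definition level (j : nat) : R := v + j.+1%:R^-1.

Lemma level_gt j : v < level j.
Proof. by rewrite ltrDl invr_gt0. Qed.

Lemma level_nonincreasing i j : (i <= j)%N -> level j <= level i.
Proof. by move=> ij; rewrite lerD2l lef_pV2 ?posrE ?ltr0n// ler_nat. Qed.

Lemma level_cvg : level @ \oo --> v.
Proof.
rewrite -[X in _ --> X]addr0; apply: cvgD; first exact: cvg_cst.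
exact: cvg_harmonic.
Qed.

Lemma level_lt x : v < x -> exists j, level j < x.
Proof.
move=> vx; have : \forall j \near \oo, level j < x.
  by apply: cvgr_lt vx; exact: level_cvg.
by case=> j _ /(_ j (leqnn j)) ?; exists j.
Qed.

Lemma absorb_level_cvg t x y : absorb (level j) t x y @[j --> \oo] --> absorb v t x y.
Proof.
have [/andP[vx vy]|] := boolP ((v < x) && (v < y)); last first.
  move=> nxy; rewrite (_ : (fun _ => _) = cst (absorb v t x y)); first exact: cvg_cst.
  apply/funext => j; rewrite /absorb (negbTE nxy); case: ifP => // /andP[jx jy].
  by move: nxy; rewrite !(lt_trans (level_gt j)).
rewrite absorbE//.
apply: (@cvg_trans _ (killed_kernel (level j) t x y @[j --> \oo])).
  apply: near_eq_cvg; near=> j; rewrite absorbE//.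
    by near: j; apply: cvgr_lt vx; exact: level_cvg.
  by near: j; apply: cvgr_lt vy; exact: level_cvg.
apply: cvgM; last exact: cvg_cst.
apply: cvgB; first exact: cvg_cst.
apply: continuous_cvg; first exact: continuous_expR.
apply: cvgN; apply: cvgM; last exact: cvg_cst.
have lin : 2 * level j - y - x @[j --> \oo] --> 2 * v - y - x.
  apply: cvgB; last exact: cvg_cst.
  apply: cvgB; last exact: cvg_cst.
  by apply: cvgM; [exact: cvg_cst|exact: level_cvg].
exact: (cvgM lin lin).
Unshelve. all: by end_near. Qed.

Section chains.
Variable h : R -> \bar R.
Hypotheses (mh : measurable_fun [set: R] h) (h0 : forall y, (0 <= h y)%E).

Let mchain w L : measurable_steps L ->
  measurable_fun [set: R] (chain (absorb w) L h).
Proof.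
move=> mL; apply: measurable_chain => //; first exact: measurable_absorb.
by move=> t x y; exact: absorb_ge0.
Qed.

Let chain0 w L x : (0 <= chain (absorb w) L h x)%E.
Proof. by apply: chain_ge0 => // t a b; exact: absorb_ge0. Qed.

Lemma absorb_chain_nondecreasing L x : measurable_steps L ->
  (forall p, p \in L -> 0 < p.1) ->
  nondecreasing_seq (fun j => chain (absorb (level j)) L h x).
Proof.
elim: L x => [|p L IHL] x mL pL i j ij; first exact: lexx.
rewrite [leLHS]/= [leRHS]/=.
have [mp mL'] := measurable_steps_cons mL.
have p0 : 0 < p.1 by apply: pL; rewrite in_cons eqxx.
have pL' q : q \in L -> 0 < q.1 by move=> qL; apply: pL; rewrite in_cons qL orbT.
apply: ge0_le_integral.
- exact: mp.
- by move=> y _; rewrite mule_ge0// lee_fin absorb_ge0.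
- by apply: measurable_kernel_integrand; [exact: measurable_absorb|exact: mchain].
- by apply: measurable_kernel_integrand; [exact: measurable_absorb|exact: mchain].
- move=> y _; apply: lee_pmul.
  + by rewrite lee_fin absorb_ge0.
  + exact: chain0.
  + rewrite lee_fin; apply: absorb_nonincreasing p0.
    exact: level_nonincreasing.
  + exact: (IHL y mL' pL' i j ij).
Qed.

(** Monotone convergence, once per step. *)
Lemma absorb_chain_cvg L x : measurable_steps L ->
  (forall p, p \in L -> 0 < p.1) ->
  chain (absorb (level j)) L h x @[j --> \oo] --> chain (absorb v) L h x.
Proof.
elim: L x => [|p L IHL] x mL pL /=; first exact: cvg_cst.
have [mp mL'] := measurable_steps_cons mL.
have p0 : 0 < p.1 by apply: pL; rewrite in_cons eqxx.
have pL' q : q \in L -> 0 < q.1 by move=> qL; apply: pL; rewrite in_cons qL orbT.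
pose f j y := ((absorb (level j) p.1 x y)%:E * chain (absorb (level j)) L h y)%E.
have -> : kernel_op (absorb v p.1) p.2 (chain (absorb v) L h) x =
    (\int[leb]_(y in p.2) limn (f ^~ y))%E.
  apply: eq_integral => y _; apply/esym/cvg_lim => //.
  have [a0|a0] := eqVneq (absorb v p.1 x y) 0.
    rewrite a0 mul0e (_ : f ^~ y = cst 0%E); first exact: cvg_cst.
    apply/funext => j; rewrite /f (_ : absorb _ _ _ _ = 0) ?mul0e//.
    apply/eqP; rewrite eq_le absorb_ge0 andbT -a0.
    by apply: absorb_nonincreasing => //; apply/ltW/level_gt.
  apply: cvgeM; last exact: IHL.
    have [bf|bn] := boolP (chain (absorb v) L h y \is a fin_num).
      exact: mule_def_fin.
    by apply: mule_def_neq0_infty => //; rewrite eqe.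
  by apply: cvg_EFin; [exact: nearW|exact: absorb_level_cvg].
apply: cvg_monotone_convergence.
- exact: mp.
- by move=> j; apply: measurable_kernel_integrand; [exact: measurable_absorb|exact: mchain].
- by move=> j y _; rewrite mule_ge0// lee_fin absorb_ge0.
- move=> y _ i j ij; apply: lee_pmul.
  + by rewrite lee_fin absorb_ge0.
  + exact: chain0.
  + rewrite lee_fin; apply: absorb_nonincreasing p0.
    exact: level_nonincreasing.
  + exact: (absorb_chain_nondecreasing y mL' pL' ij).
Qed.

End chains.

End level_limit.

(** * Measures on tuples and independence *)

Section density.
Context d (T : measurableType d) (R : realType).
Variables (mu nu : {measure set T -> \bar R}) (p : T -> R).
Hypotheses (mp : measurable_fun [set: T] p) (p0 : forall x, 0 <= p x).
Hypothesis nuE : forall A, measurable A -> (nu A = \int[mu]_(x in A) (p x)%:E)%E.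
Import HBNNSimple.

Lemma ge0_integral_density (f : T -> \bar R) :
  measurable_fun [set: T] f -> (forall x, 0 <= f x)%E ->
  (\int[nu]_x f x = \int[mu]_x ((p x)%:E * f x))%E.
Proof.
move=> mf f0; pose h := nnsfun_approx measurableT mf.
have mph n : measurable_fun [set: T] (fun x => (p x)%:E * (h n x)%:E)%E.
  by apply: emeasurable_funM; exact/measurable_EFinP.
have hf x : EFin \o h ^~ x @ \oo --> f x by exact: cvg_nnsfun_approx.
have nd x i j : (i <= j)%N -> h i x <= h j x.
  by move=> ij; exact/lefP/nd_nnsfun_approx.
transitivity (limn (fun n => \int[nu]_x (h n x)%:E))%E.
  rewrite -monotone_convergence//.
  - by apply: eq_integral => x _; apply/esym/cvg_lim => //; exact: hf.
  - by move=> n; exact/measurable_EFinP.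
  - by move=> n x _; rewrite lee_fin.
  - by move=> x _ i j ij; rewrite lee_fin; exact: nd.
transitivity (limn (fun n => \int[mu]_x ((p x)%:E * (h n x)%:E)))%E; last first.
  rewrite -monotone_convergence//.
  - apply: eq_integral => x _; apply/cvg_lim => //.
    by apply: cvgeZl => //; exact: hf.
  - by move=> n x _; rewrite -EFinM lee_fin mulr_ge0.
  - by move=> x _ i j ij; rewrite -!EFinM lee_fin ler_wpM2l// nd.
congr (limn _); apply/funext => n.
rewrite integralT_nnsfun sintegralE.
under [RHS]eq_integral => x _.
  rewrite (fimfunE (h n) x) -fsumEFin// ge0_mule_fsumr; last first.
    by move=> r; exact: nnfun_muleindic_ge0.
  over.
rewrite ge0_integral_fsum//; last 2 first.
- move=> r; apply: emeasurable_funM; first exact/measurable_EFinP.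
  by apply/measurable_EFinP; exact: measurable_funM.
- move=> r x _; rewrite mule_ge0 ?lee_fin//.
  exact: nnfun_muleindic_ge0.
apply: eq_fsbigr => r; rewrite inE => -[x _ <-].
have mA : measurable (h n @^-1` [set h n x]) by exact: measurable_funPTI.
rewrite nuE// integral_mkcond -ge0_integralZl_EFin//.
- apply: eq_integral => y _; rewrite muleC -!EFinM indicE /patch.
  by case: ifPn => _; rewrite ?mulr1 ?mulr0 ?mule0 ?mul0r ?mul0e// mulrC.
- by move=> y _; apply: erestrict_ge0 => z _; rewrite lee_fin.
- apply/(measurable_restrictT _ _).1 => //; apply: measurable_funTS.
  exact/measurable_EFinP.
Qed.
End density.

Section tuple_boxes.
Context {R : realType}.
Notation mR := (measurableTypeR R).

Definition box n (A : 'I_n -> set mR) : set (n.-tuple mR) :=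
  [set y | forall i, A i (tnth y i)].

Lemma measurable_box n (A : 'I_n -> set mR) :
  (forall i, measurable (A i)) -> measurable (box A).
Proof.
move=> mA; rewrite (_ : box A = \bigcap_(i in setT) ((@tnth n _)^~ i @^-1` A i)).
  apply: fin_bigcap_measurable => // i _.
  by have := @measurable_tnth _ mR n i measurableT _ (mA i); rewrite setTI.
by apply/seteqP; split => y Ay i => [_|]; exact: Ay.
Qed.

(** Boxes form a pi-system that generates the product sigma-algebra. *)
Lemma tuple_measure_unique n (m1 m2 : {measure set (n.-tuple mR) -> \bar R}) :
  (m1 setT < +oo)%E ->
  (forall A : 'I_n -> set mR, (forall i, measurable (A i)) ->
    m1 (box A) = m2 (box A)) ->
  forall W, measurable W -> m1 W = m2 W.
Proof.
move=> m1oo m12.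
pose G := [set W | exists2 A : 'I_n -> set mR,
  (forall i, measurable (A i)) & W = box A].
have GT : G setT by exists (fun=> setT) => //; apply/seteqP; split.
apply: (measure_unique G (fun=> setT)) => //.
- apply/seteqP; split.
    apply: smallest_sub; first exact: smallest_sigma_algebra.
    rewrite -bigcup_seq => W [i _ [A mA <-]].
    apply: sub_sigma_algebra.
    exists (fun j => if j == i then A else setT).
      by move=> j; case: ifP.
    rewrite setTI; apply/seteqP; split => y /=; last by move=> /(_ i); rewrite eqxx.
    by move=> Ay j; case: eqP => [->|].
  apply: smallest_sub; first exact: sigma_algebra_measurable.
  by move=> W [A mA ->]; exact: measurable_box.
- move=> W1 W2 [A1 mA1 ->] [A2 mA2 ->]; exists (fun i => A1 i `&` A2 i).
    by move=> i; exact: measurableI.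
  apply/seteqP; split => y /=; first by move=> [h1 h2] i; split; [exact: h1|exact: h2].
  by move=> h; split => i; case: (h i).
- by apply: bigcup_const; exists 0%N.
- by move=> W [A mA ->]; exact: m12.
Qed.

End tuple_boxes.

Section restricted_law.
Context {R : realType} d {T : measurableType d} d' {U : measurableType d'}.
Variables (P : probability T R) (G : set T) (Y : T -> U).
Hypotheses (mG : measurable G) (mY : measurable_fun [set: T] Y).

(** The measurability proofs are arguments, so that the measure structure can be
    inferred from the term. *)
Definition restricted_law of measurable G & measurable_fun [set: T] Y :
  set U -> \bar R := fun A => P (Y @^-1` A `&` G).

Notation m := (restricted_law mG mY).

Let mpre A : measurable A -> measurable (Y @^-1` A `&` G).
Proof.
by move=> mA; apply: measurableI => //; rewrite -[X in measurable X]setTI; exact: mY.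
Qed.

Let m0 : m set0 = 0%E.
Proof. by rewrite /restricted_law preimage_set0 set0I measure0. Qed.

Let m_ge0 A : (0 <= m A)%E. Proof. exact: measure_ge0. Qed.

Let m_sigma_additive : semi_sigma_additive m.
Proof.
move=> F mF tF mUF; rewrite /restricted_law preimage_bigcup setI_bigcupl.
apply: measure_semi_sigma_additive.
- by move=> i; exact: mpre.
- apply/trivIsetP => i j _ _ ij; rewrite setIACA -preimage_setI.
  by move/trivIsetP : tF => /(_ _ _ Logic.I Logic.I ij) ->; rewrite preimage_set0 set0I.
- by rewrite -setI_bigcupl -preimage_bigcup; exact: mpre.
Qed.

HB.instance Definition _ := isMeasure.Build _ _ _ m m0 m_ge0 m_sigma_additive.

Let m_fin : fin_num_fun m.
Proof. by move=> A mA; rewrite fin_num_measure//; exact: mpre. Qed.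

HB.instance Definition _ := Measure_isFinite.Build _ _ _ m m_fin.

Lemma integral_restricted_law (f : U -> \bar R) :
  measurable_fun [set: U] f -> (forall u, 0 <= f u)%E ->
  (\int[m]_u f u = \int[P]_(w in G) f (Y w))%E.
Proof.
move=> mf f0.
have mfY : measurable_fun [set: T] (f \o Y) by exact: measurableT_comp.
transitivity (\int[mrestr P mG]_w f (Y w))%E.
  by rewrite -[RHS](ge0_integral_pushforward mY (mrestr P mG) measurableT).
rewrite (@ge0_negligible_integral _ _ _ _ _ (~` G))//.
- rewrite setTD setCK; apply: eq_measure_integral => A mA AG.
  by rewrite /= /mrestr setIidl.
- exact: measurableC.
- by rewrite /= /mrestr setICl measure0.
Qed.

End restricted_law.

Section independence.
Context {R : realType} d {T : measurableType d}.
Notation mR := (measurableTypeR R).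
Notation leb := (@lebesgue_measure R).
Variable P : probability T R.

(** Both sides are finite measures in W, so boxes suffice. *)
Lemma tuple_event_independent n (Y : T -> n.-tuple mR) (C : set T) :
  measurable_fun [set: T] Y -> measurable C ->
  (forall A : 'I_n -> set mR, (forall i, measurable (A i)) ->
    P (Y @^-1` box A `&` C) = P (Y @^-1` box A) * P C)%E ->
  forall W, measurable W -> (P (Y @^-1` W `&` C) = P (Y @^-1` W) * P C)%E.
Proof.
move=> mY mC indep W mW.
have PC : P C = (fine (P C))%:E by rewrite fineK// fin_num_measure.
have c0 : 0 <= fine (P C) by rewrite fine_ge0.
pose m1 := restricted_law P mC mY.
pose m2 := mscale (NngNum c0) (restricted_law P measurableT mY).
have m2E B : m2 B = (P (Y @^-1` B) * P C)%E.
  rewrite -[LHS]/((fine (P C))%:E * P (Y @^-1` B `&` setT))%E.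
  by rewrite setIT -PC muleC.
rewrite -[LHS]/(m1 W) -m2E; apply: tuple_measure_unique mW.
  by rewrite ltey_eq fin_num_measure.
by move=> A mA; rewrite -[RHS]/(m2 (box A)) m2E; exact: indep.
Qed.

(** One step of the Markov property: on G the pair (U, Z) has a product law, and
    the sum is integrated by Fubini. *)
Lemma integral_independent_sum (G : set T) (U Z : T -> R) (t : R)
    (g : R -> \bar R) :
  0 < t -> measurable G ->
  measurable_fun [set: T] U -> measurable_fun [set: T] Z ->
  (forall C : set mR, measurable C -> P (Z @^-1` C) = normal_prob 0 (Num.sqrt t) C) ->
  (forall A C : set mR, measurable A -> measurable C ->
    P ((U @^-1` A `&` G) `&` Z @^-1` C) = P (U @^-1` A `&` G) * P (Z @^-1` C))%E ->
  measurable_fun [set: R] g -> (forall y, 0 <= g y)%E ->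
  (\int[P]_(w in G) g (U w + Z w)%R =
   \int[P]_(w in G) \int[leb]_y ((heat t (U w) y)%:E * g y))%E.
Proof.
move=> t0 mG mU mZ lawZ indep mg g0.
have mUZ : measurable_fun [set: T] (fun w => (U w, Z w) : mR * mR).
  exact: measurable_fun_pair.
pose nu := @restricted_law R d T _ mR P G U mG mU.
have mg2 : measurable_fun [set: mR * mR] (fun z : mR * mR => g (z.1 + z.2)).
  by apply: measurableT_comp => //; exact: measurable_funD.
rewrite -(integral_restricted_law P mG mUZ mg2)//.
transitivity (\int[(nu \x normal_prob 0 (Num.sqrt t))%E]_z g (z.1 + z.2)%R)%E.
  apply: eq_measure_integral => X mX _; apply/esym.
  apply: product_measure_unique => // A C mA mC.
  rewrite /= -lawZ// -indep// /restricted_law; congr (P _).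
  by apply/seteqP; split => w /=; tauto.
rewrite fubini_tonelli1//.
have mF : measurable_fun [set: R] (fun u => \int[leb]_y ((heat t u y)%:E * g y))%E.
  apply: (measurable_kernel_op (A := setT)) => //; first exact: measurable_heat.
  by move=> *; exact: heat_ge0.
rewrite -(@integral_restricted_law R d T _ mR P G U mG mU _ mF); last first.
  by move=> u; apply: integral_ge0 => y _; rewrite mule_ge0// lee_fin heat_ge0.
apply: eq_integral => u _; rewrite /fubini_F /=.
have mgu : measurable_fun [set: R] (fun z => g (u + z)).
  by apply: measurableT_comp => //; exact: measurable_funD.
have mpdf := measurable_normal_pdf (0 : R) (Num.sqrt t).
rewrite (ge0_integral_density mpdf (normal_pdf_ge0 _ _)
  (nu := normal_prob 0 (Num.sqrt t)) (fun A mA => erefl))//.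
rewrite [RHS](ge0_integral_shift u)//.
- apply: eq_integral => z _; rewrite -heat_normal// /heat subr0.
  by rewrite addrAC subrr add0r.
- exact: (measurable_kernel_integrand (A := setT) u (measurable_heat t) mg).
- by move=> y; rewrite mule_ge0// lee_fin heat_ge0.
Qed.

End independence.

(** * The Markov property of the drifted process *)

Section visits.
Context {R : realType} {T : Type}.
Notation mR := (measurableTypeR R).
Variable X : R -> T -> R.
Implicit Types (L : seq (R * set mR)) (a : R) (w : T).

Fixpoint visits L a w : Prop :=
  if L is p :: L' then p.2 (X (a + p.1) w) /\ visits L' (a + p.1) w else True.

Lemma duration_cons (p : R * set mR) L : duration (p :: L) = p.1 + duration L.
Proof. by rewrite /duration big_cons. Qed.

Lemma duration_cat L1 L2 : duration (L1 ++ L2) = duration L1 + duration L2.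
Proof. by rewrite /duration big_cat. Qed.

Lemma duration_rcons L (p : R * set mR) :
  duration (rcons L p) = duration L + p.1.
Proof. by rewrite -cats1 duration_cat duration_cons /duration big_nil addr0. Qed.

Lemma duration_ge0 L : (forall p, p \in L -> 0 < p.1) -> 0 <= duration L.
Proof.
by move=> pL; rewrite /duration big_seq_cond sumr_ge0// => p /andP[/pL/ltW].
Qed.

Lemma visits_cat L1 L2 a w :
  visits (L1 ++ L2) a w <-> visits L1 a w /\ visits L2 (a + duration L1) w.
Proof.
elim: L1 a => [|p L1 IHL] a /=.
  by rewrite /duration big_nil addr0; tauto.
by rewrite IHL duration_cons addrA; tauto.
Qed.

Lemma visitsP p0 L a w : visits L a w <->
  forall k, (k < size L)%N ->
    (nth p0 L k).2 (X (a + duration (take k.+1 L)) w).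
Proof.
elim: L a => [|p L IHL] a //=; rewrite IHL; split.
  move=> [h0 h] [_|k kL] /=; last by rewrite duration_cons addrA; exact: h.
  by rewrite take0 duration_cons /duration big_nil addr0.
move=> h; split.
  by have := h 0%N isT; rewrite take0 duration_cons /duration big_nil addr0.
by move=> k kL; have := h k.+1 kL; rewrite /= duration_cons addrA.
Qed.

End visits.

Section markov_chain.
Context {R : realType} d {T : measurableType d}.
Notation mR := (measurableTypeR R).
Notation leb := (@lebesgue_measure R).
Variables (P : probability T R) (B : R -> T -> R) (mu s0 x : R).
Hypothesis hB : brownian_after P B s0.
Hypothesis hx : P [set w | drifted mu B s0 w = x] = 1%E.
Notation X := (drifted mu B).
Implicit Types (L : seq (R * set mR)) (a : R) (w : T).

Lemma measurable_drifted a : s0 <= a -> measurable_fun [set: T] (X a).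
Proof.
by move=> sa; apply: measurable_funD => //; exact: (brownian_measurable hB).
Qed.

Lemma measurable_preimage (U : T -> R) (A : set mR) :
  measurable_fun [set: T] U -> measurable A -> measurable (U @^-1` A).
Proof. by move=> mU mA; rewrite -[X in measurable X]setTI; exact: mU. Qed.

Lemma measurable_visits L a : s0 <= a -> measurable_steps L ->
  (forall p, p \in L -> 0 < p.1) -> measurable [set w | visits X L a w].
Proof.
elim: L a => [|p L IHL] a sa mL pL /=.
  by rewrite (_ : [set _ | True] = setT)//; apply/seteqP.
have [mp mL'] := measurable_steps_cons mL.
have p0 : 0 < p.1 by apply: pL; rewrite in_cons eqxx.
have sap : s0 <= a + p.1 by rewrite (le_trans sa)// lerDl ltW.
rewrite (_ : [set w | _] =
  X (a + p.1) @^-1` p.2 `&` [set w | visits X L (a + p.1) w]); last by apply/seteqP; split=> w.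
apply: measurableI; first exact: (measurable_preimage (measurable_drifted sap)).
by apply: IHL => // q qL; apply: pL; rewrite in_cons qL orbT.
Qed.

Lemma measurable_start : measurable [set w | X s0 w = x].
Proof.
exact: (measurable_preimage (A := [set x]) (measurable_drifted (lexx s0))).
Qed.

Lemma probability_not_start : P (~` [set w | X s0 w = x]) = 0%E.
Proof. by rewrite probability_setC ?hx ?subee//; exact: measurable_start. Qed.

(** Events may be changed where the process does not start from x. *)
Lemma probability_start_setI (F : set T) : measurable F ->
  P F = P (F `&` [set w | X s0 w = x]).
Proof.
move=> mF; set E := [set w | _]; have mE : measurable E by exact: measurable_start.
have PE : P (~` E) = 0%E by exact: probability_not_start.
have P0 : P (F `\` E) = 0%E.
  apply/eqP; rewrite eq_le measure_ge0 andbT -PE; apply: le_measure.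
  - by rewrite inE; exact: measurableD.
  - by rewrite inE; exact: measurableC.
  - by move=> w [].
rewrite -[in LHS](setUIDK F E) measureU.
- by rewrite -[RHS]adde0; congr (_ + _)%E; exact: P0.
- exact: measurableI.
- exact: measurableD.
- by rewrite setDE setIACA setICr setI0.
Qed.

(** The past of the process along a sequence of steps is, up to a null set, an
    event on the tuple of its increments, hence independent of the next one. *)
Lemma increment_independent L t (A C : set mR) : 0 < t ->
  measurable_steps L -> (forall p, p \in L -> 0 < p.1) ->
  measurable A -> measurable C ->
  let e := s0 + duration L in
  let G := [set w | visits X L s0 w] in
  let Z := fun w => B (e + t) w - B e w in
  (P ((X e @^-1` A `&` G) `&` Z @^-1` C) =
   P (X e @^-1` A `&` G) * P (Z @^-1` C))%E.
Proof.
move=> t0 mL pL mA mC e G Z.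
pose q : R * set mR := (t, setT).
pose n := size L; pose LL := rcons L q.
pose r k := s0 + duration (take k LL).
have rS j : (j < n.+1)%N -> r j.+1 = r j + (nth q LL j).1.
  move=> jn; rewrite /r (take_nth q) ?size_rcons//.
  by rewrite duration_rcons addrA.
have rlt j : (j < n.+1)%N -> r j < r j.+1.
  move=> jn; rewrite rS// ltrDl.
  have : nth q LL j \in LL by rewrite mem_nth// size_rcons.
  by rewrite mem_rcons in_cons => /orP[/eqP->//|/pL].
have r0 : r 0%N = s0 by rewrite /r take0 /duration big_nil addr0.
have rtake k : (k <= n)%N -> r k = s0 + duration (take k L).
  by move=> kn; rewrite /r /LL -cats1 takel_cat.
have rn : r n = e by rewrite rtake// take_size.
have rn1 : r n.+1 = e + t by rewrite rS// rn /LL nth_rcons ltnn eqxx.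
have rge k : (k <= n.+1)%N -> s0 <= r k.
  elim: k => [|k IHk] kn; first by rewrite r0.
  by rewrite (le_trans (IHk (ltnW kn)))// ltW// rlt.
pose inc (j : nat) w := B (r j.+1) w - B (r j) w.
have minc j : (j < n.+1)%N -> measurable_fun [set: T] (inc j).
  move=> jn; apply: measurable_funB; apply: (brownian_measurable hB).
    exact: rge.
  by apply: rge; exact: ltnW.
pose Y w : n.-tuple mR := [tuple inc i w | i < n].
have mY : measurable_fun [set: T] Y.
  apply/measurable_fun_tnthP => i.
  rewrite (_ : _ \o _ = inc i); last by apply/funext => w /=; rewrite tnth_mktuple.
  by apply: minc; exact/ltnW/ltn_ord.
have incn : inc n = Z by rewrite /inc rn rn1.
have indep (A' : 'I_n -> set mR) (C' : set mR) : (forall i, measurable (A' i)) ->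
    measurable C' ->
    (P (Y @^-1` box A' `&` Z @^-1` C') =
     (\prod_(i < n) P (inc i @^-1` A' i)) * P (Z @^-1` C'))%E.
  move=> mA' mC'.
  (* the constraint on the next increment is put on the last coordinate *)
  pose F (i : 'I_n.+1) : set mR := oapp A' C' (insub (val i)).
  have Fw i : F (widen_ord (leqnSn n) i) = A' i.
    by rewrite /F /= insubT //= => ?; congr (A' _); apply: val_inj.
  have Fm : F ord_max = C' by rewrite /F insubF//= ltnn.
  have mF i : measurable (F i) by rewrite /F; case: insubP => //=.
  have := brownian_independent hB (n := n.+1) (r := r).
  rewrite r0 lexx => /(_ isT rlt F mF); rewrite big_ord_recr /= Fm.
  under eq_bigr do rewrite Fw.
  rewrite -/(inc n) incn => <-; congr (P _); apply/seteqP; split => w /=.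
    move=> [hb hc] i; have [j ->|->] := unliftP ord_max i.
      have -> : lift ord_max j = widen_ord (leqnSn n) j.
        by apply: val_inj; rewrite /= /bump leqNgt ltn_ord.
      by rewrite Fw; have := hb j; rewrite tnth_mktuple.
    by rewrite Fm; move: hc; rewrite -incn.
  move=> h; split.
    by move=> i; rewrite tnth_mktuple; have := h (widen_ord (leqnSn n) i); rewrite Fw.
  by have := h ord_max; rewrite Fm -incn.
have boxT (A' : 'I_n -> set mR) : (forall i, measurable (A' i)) ->
    (P (Y @^-1` box A') = \prod_(i < n) P (inc i @^-1` A' i))%E.
  move=> mA'; have := indep A' setT mA' measurableT.
  by rewrite preimage_setT setIT probability_setT mule1.
(* the position after k steps, rebuilt from the increments and the start x *)
pose phi k (z : n.-tuple mR) : R :=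
  x + mu * (r k - s0) + \sum_(i < n) (if (i < k)%N then tnth z i else 0).
have mphi k : measurable_fun [set: n.-tuple mR] (phi k).
  apply: measurable_funD => //; apply: measurable_sum => i.
  by case: (i < k)%N => //; exact: (@measurable_tnth _ mR n i).
have phiE k w : (k <= n)%N -> X s0 w = x -> phi k (Y w) = X (r k) w.
  move=> kn Xw; rewrite /phi.
  have -> : \sum_(i < n) (if (i < k)%N then tnth (Y w) i else 0) = B (r k) w - B s0 w.
    rewrite -big_mkcond /=.
    under eq_bigr do rewrite tnth_mktuple.
    rewrite -(big_mkord (fun i => (i < k)%N) (fun i => inc i w)).
    rewrite -(big_nat_widen 0 k n xpredT (fun i => inc i w) kn).
    by rewrite telescope_sumr// r0.
  by rewrite -Xw /drifted; ring.
pose W := (phi n @^-1` A) `&` \bigcap_(i in [set: 'I_n]) (phi i.+1 @^-1` (nth q L i).2).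
have mpre k (D : set mR) : measurable D -> measurable (phi k @^-1` D).
  by move=> mD; rewrite -[X in measurable X]setTI; exact: mphi.
have mW : measurable W.
  apply: measurableI; first exact: mpre.
  by apply: fin_bigcap_measurable => // i _; apply: mpre; apply: mL; exact: mem_nth.
have WE w : X s0 w = x -> Y w \in W <-> (X e @^-1` A `&` G) w.
  move=> Xw; rewrite inE /W /G /= phiE// rn (visitsP _ q).
  split=> -[hA h]; split => //.
    by move=> k kn; have := h (Ordinal kn) I; rewrite /= phiE// rtake.
  by move=> i _ /=; rewrite phiE// rtake//; exact: h.
have mG : measurable G by exact: measurable_visits.
have se : s0 <= e by rewrite lerDl duration_ge0.
have mXA : measurable (X e @^-1` A `&` G).
  apply: measurableI => //; exact: measurable_preimage (measurable_drifted se) mA.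
have mZ : measurable_fun [set: T] Z by rewrite -incn; exact: minc.
have mZC : measurable (Z @^-1` C) by exact: measurable_preimage.
have mYW : measurable (Y @^-1` W).
  by rewrite -[X in measurable X]setTI; exact: mY.
have swap (D : set T) : measurable D ->
    P ((X e @^-1` A `&` G) `&` D) = P (Y @^-1` W `&` D).
  move=> mD; rewrite probability_start_setI; last exact: measurableI.
  rewrite [RHS]probability_start_setI; last exact: measurableI.
  congr (P _); apply/seteqP; split => w [[h1 h2] Xw]; (split; last by []); split => //.
    by have := (WE w Xw).2 h1; rewrite inE.
  by apply: (WE w Xw).1; rewrite inE.
rewrite swap// -[X e @^-1` A `&` G]setIT swap// setIT.
apply: tuple_event_independent => // A' mA'.
by rewrite indep// boxT.
Qed.

Definition drift_heat t y z : R := heat t (y + mu * t) z.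

Lemma jointly_measurable_drift_heat t : jointly_measurable (drift_heat t).
Proof.
have mg : measurable_fun [set: mR * mR]
    (fun z : mR * mR => ((z.1 + mu * t, z.2) : mR * mR)).
  apply: measurable_fun_pair => //.
  exact: (measurable_funD (g := cst (mu * t))).
exact: (measurableT_comp (measurable_heat t) mg).
Qed.

(** The Markov property. The free terminal function h carries the induction on the
    last step. *)
Lemma integral_visits L (h : R -> \bar R) : measurable_steps L ->
  (forall p, p \in L -> 0 < p.1) ->
  measurable_fun [set: R] h -> (forall y, 0 <= h y)%E ->
  (\int[P]_(w in [set w | visits X L s0 w]) h (X (s0 + duration L) w) =
   chain drift_heat L h x)%E.
Proof.
elim/last_ind: L h => [|L p IHL] h mL pL mh h0.
  rewrite /duration big_nil addr0 /=.
  rewrite (_ : [set _ | True] = setT); last by apply/seteqP; split=> w.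
  have mhX : measurable_fun [set: T] (fun w => h (X s0 w)).
    exact: measurableT_comp mh (measurable_drifted (lexx s0)).
  have mE := measurable_start.
  rewrite (@ge0_negligible_integral _ _ _ _ _ (~` [set w | X s0 w = x]))//.
  - rewrite setTD setCK.
    rewrite (_ : (\int[P]_(w in _) _)%E = (\int[P]_(w in [set w | X s0 w = x]) h x)%E).
      by rewrite integral_cst// -[RHS]mule1; congr (_ * _)%E; exact: hx.
    by apply: eq_integral => w; rewrite inE => /= ->.
  - exact: measurableC.
  - exact: probability_not_start.
have mp : measurable p.2 by apply: mL; rewrite mem_rcons mem_head.
have p0 : 0 < p.1 by apply: pL; rewrite mem_rcons mem_head.
have mL' : measurable_steps L by move=> q qL; apply: mL; rewrite mem_rcons in_cons qL orbT.
have pL' q : q \in L -> 0 < q.1 by move=> qL; apply: pL; rewrite mem_rcons in_cons qL orbT.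
set e := s0 + duration L.
have se : s0 <= e by rewrite lerDl duration_ge0.
have sep : s0 <= e + p.1 by rewrite (le_trans se)// lerDl ltW.
set G := [set w | visits X L s0 w].
have mG : measurable G by exact: measurable_visits.
have -> : [set w | visits X (rcons L p) s0 w] = G `&` X (e + p.1) @^-1` p.2.
  by apply/seteqP; split => w /=; rewrite -cats1 visits_cat /=; tauto.
rewrite duration_rcons addrA -/e.
pose g := h \_ p.2.
have mg : measurable_fun [set: R] g by exact: measurable_patch.
have g0 y : (0 <= g y)%E by exact: patch_ge0.
transitivity (\int[P]_(w in G) g (X (e + p.1) w))%E.
  rewrite integral_mkcondr; apply: eq_integral => w _.
  by rewrite /g /patch; congr (if _ then _ else _); apply/idP/idP; rewrite !inE.
pose U w := X e w + mu * p.1.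
pose Z w := B (e + p.1) w - B e w.
have mU : measurable_fun [set: T] U.
  by apply: measurable_funD => //; exact: measurable_drifted.
have mZ : measurable_fun [set: T] Z.
  by apply: measurable_funB; exact: (brownian_measurable hB).
transitivity (\int[P]_(w in G) g (U w + Z w)%R)%E.
  by apply: eq_integral => w _; congr g; rewrite /U /Z /drifted; ring.
rewrite (integral_independent_sum p0 mG mU mZ _ _ mg g0); last 2 first.
- move=> C mC; have ee : e < e + p.1 by rewrite ltrDl.
  apply: etrans (brownian_gaussian hB se ee mC) _.
  by rewrite (addrAC e) subrr add0r.
- move=> A C mA mC.
  have mA' : measurable ((fun y : mR => y + mu * p.1) @^-1` A).
    rewrite -[X in measurable X]setTI.
    by apply: (measurable_funD (g := cst (mu * p.1))).
  exact: (increment_independent p0 mL' pL' mA' mC).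
transitivity (\int[P]_(w in G) kernel_op (drift_heat p.1) p.2 h (X e w))%E.
  apply: eq_integral => w _; rewrite /kernel_op [RHS]integral_mkcond.
  apply: eq_integral => y _; rewrite /g /patch /drift_heat.
  by case: ifP => // _; rewrite mule0.
rewrite IHL//.
- by rewrite -cats1 chain_cat.
- apply: measurable_kernel_op => //; first exact: jointly_measurable_drift_heat.
  by move=> *; exact: heat_ge0.
- by move=> y; apply: kernel_op_ge0 => // z _; exact: heat_ge0.
Qed.

Lemma probability_visits L : measurable_steps L ->
  (forall p, p \in L -> 0 < p.1) ->
  P [set w | visits X L s0 w] = chain drift_heat L (cst 1%E) x.
Proof.
move=> mL pL; rewrite -integral_visits// integral_cst ?mul1e//.
exact: measurable_visits.
Qed.

End markov_chain.

(** * Paths observed on refining grids *)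

Section grid_points.
Context {R : realType} {T : Type}.
Notation mR := (measurableTypeR R).
Variable X : R -> T -> R.
Implicit Types (L : seq (R * set mR)) (a b c t : R) (w : T).

Let visits_nseq k t (A : set mR) a w : visits X (nseq k (t, A)) a w <->
  forall i, (0 < i <= k)%N -> A (X (a + i%:R * t) w).
Proof.
elim: k a => [|k IHk] a /=; first by split => // _ [|i].
rewrite IHk; split.
  move=> [h1 h] [//|[_|i ik]]; first by rewrite mul1r.
  by have := h i.+1 ik; rewrite -[i.+2]add1n natrD mulrDl mul1r addrA.
move=> h; split; first by have := h 1%N isT; rewrite mul1r.
move=> [//|i] ik; have := h i.+2 ik.
by rewrite -[i.+2]add1n natrD mulrDl mul1r addrA.
Qed.

Let duration_nseq k t (A : set mR) : duration (nseq k (t, A)) = k%:R * t.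
Proof.
elim: k => [|k IHk] /=; first by rewrite /duration big_nil mul0r.
by rewrite duration_cons IHk /= -[k.+1]add1n natrD mulrDl mul1r.
Qed.

Let pred_steps t m : (4 ^ m).-1%:R * (t / (4 ^ m)%:R) + t / (4 ^ m)%:R = t.
Proof.
have N0 : (0 < 4 ^ m)%N by rewrite expn_gt0.
rewrite -[X in _ + X]mul1r -mulrDl -(natrD _ _ 1) addn1 prednK//.
by rewrite mulrC divfK// pnatr_eq0 -lt0n.
Qed.

Lemma visits_refine_cons c m (p : R * set mR) L a w :
  visits X (refine c m (p :: L)) a w <->
  [/\ forall i, (0 < i <= 4 ^ m)%N -> c < X (a + i%:R * (p.1 / (4 ^ m)%:R)) w,
      p.2 (X (a + p.1) w) & visits X (refine c m L) (a + p.1) w].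
Proof.
rewrite /refine /= visits_cat -/(refine c m L).
set t := p.1 / _.
have N0 : (0 < 4 ^ m)%N by rewrite expn_gt0.
have Nt : (4 ^ m)%:R * t = p.1 by rewrite /t mulrC divfK// pnatr_eq0 -lt0n.
have Nt1 := pred_steps p.1 m; rewrite -/t in Nt1.
rewrite duration_rcons duration_nseq Nt1.
have Ntm : a + (4 ^ m).-1%:R * t + t = a + p.1 by rewrite -addrA Nt1.
rewrite -cats1 visits_cat visits_nseq /= duration_nseq.
rewrite Ntm; split.
  move=> [[h [[hc hp] _]] hL]; split => // i /andP[i0 iN].
  have [iN1|] := leqP i (4 ^ m).-1.
    by have := h i; rewrite i0 iN1 in_itv/= andbT; exact.
  rewrite prednK// => Ni; have -> : i = (4 ^ m)%N by apply/eqP; rewrite eqn_leq iN Ni.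
  by rewrite Nt; move: hc; rewrite in_itv/= andbT.
move=> [h hp hL]; split => //; split; last first.
  split => //; split => //=; rewrite in_itv/= andbT.
  by have := h (4 ^ m)%N; rewrite N0 leqnn Nt; exact.
move=> i /andP[i0 iN]; rewrite in_itv/= andbT; apply: h.
by rewrite i0 (leq_trans iN)// leq_pred.
Qed.

Lemma visits_refine_last c m L a w : visits X (refine c m L) a w ->
  visits X L a w.
Proof.
elim: L a => //= p L IHL a /visits_refine_cons[_ hp hL]; split => //.
exact: IHL.
Qed.

Lemma visits_refineS c m L a w : visits X (refine c m.+1 L) a w ->
  visits X (refine c m L) a w.
Proof.
elim: L a => //= p L IHL a /visits_refine_cons[h hp hL].
apply/visits_refine_cons; split => //; last exact: IHL.
move=> i /andP[i0 iN]; have := h (4 * i)%N.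
rewrite muln_gt0 i0 expnS leq_pmul2l// iN => /(_ isT).
rewrite !natrM -mulrA (_ : 4%:R * _ = i%:R * (p.1 / (4 ^ m)%:R))//.
by field; rewrite pnatr_eq0 expn_eq0.
Qed.

Lemma visits_refine_level b c m L a w : b <= c ->
  visits X (refine c m L) a w -> visits X (refine b m L) a w.
Proof.
move=> bc; elim: L a => //= p L IHL a /visits_refine_cons[h hp hL].
apply/visits_refine_cons; split => //; last exact: IHL.
by move=> i iN; rewrite (le_lt_trans bc)// h.
Qed.

(** Only the part of the targets above c matters when staying above c. *)
Definition restrict_steps c L : seq (R * set mR) :=
  [seq (p.1, p.2 `&` `]c, +oo[%classic) | p <- L].

Lemma visits_refine_restrict c m L a w : visits X (refine c m L) a w ->
  visits X (refine c m (restrict_steps c L)) a w.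
Proof.
elim: L a => //= p L IHL a /visits_refine_cons[h hp hL].
apply/visits_refine_cons; split => //=; last exact: IHL.
split => //; rewrite in_itv/= andbT.
have N0 : (0 < 4 ^ m)%N by rewrite expn_gt0.
have := h (4 ^ m)%N; rewrite N0 leqnn => /(_ isT).
by rewrite mulrC divfK// pnatr_eq0 -lt0n.
Qed.

Lemma duration_refine c m L : duration (refine c m L) = duration L.
Proof.
elim: L => [//|p L IHL].
rewrite /refine /= duration_cat -/(refine c m L) IHL duration_cons; congr (_ + _).
by rewrite duration_rcons duration_nseq pred_steps.
Qed.

Lemma refine_gt0 c m L : (forall p, p \in L -> 0 < p.1) ->
  forall p, p \in refine c m L -> 0 < p.1.
Proof.
elim: L => [_ q|p L IHL pL q]; first by rewrite in_nil.
have p0 : 0 < p.1 / (4 ^ m)%:R.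
  by rewrite divr_gt0 ?ltr0n ?expn_gt0// pL// mem_head.
rewrite /refine /= mem_cat mem_rcons in_cons mem_nseq -orbA.
case/or3P => [/eqP ->//|/andP[_ /eqP ->]//|]; apply: IHL => p' p'L.
by apply: pL; rewrite in_cons p'L orbT.
Qed.

Lemma above_visits_refine c m L a w : (forall p, p \in L -> 0 < p.1) ->
  (forall z, a <= z <= a + duration L -> c < X z w) ->
  visits X L a w -> visits X (refine c m L) a w.
Proof.
elim: L a => //= p L IHL a pL h [hp hL].
have p0 : 0 < p.1 by apply: pL; rewrite mem_head.
have pL' q : q \in L -> 0 < q.1 by move=> qL; apply: pL; rewrite in_cons qL orbT.
have dL := duration_ge0 pL'.
apply/visits_refine_cons; split => //.
- move=> i /andP[i0 iN]; apply: h; apply/andP; split.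
    by rewrite lerDl mulr_ge0// divr_ge0// ltW.
  rewrite duration_cons lerD2l -[leLHS]addr0 lerD//.
  rewrite mulrCA -[leRHS]mulr1 ler_pM2l// ler_pdivrMr ?ltr0n ?expn_gt0//.
  by rewrite mul1r ler_nat.
- apply: IHL => // z /andP[z1 z2]; apply: h; rewrite duration_cons addrA z2 andbT.
  by rewrite (le_trans _ z1)// lerDl ltW.
Qed.

(** The grids become dense, so a continuous path that is above c on all of them
    never goes below c. *)
Lemma visits_refine_above c L s a w : s <= a -> (forall p, p \in L -> 0 < p.1) ->
  {within `[s, +oo[, continuous (X ^~ w)} -> c < X a w ->
  (forall m, visits X (refine c m L) a w) ->
  forall z, a <= z <= a + duration L -> c <= X z w.
Proof.
move=> + + cX; elim: L a => [|p L IHL] a sa pL ca h z.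
  rewrite /duration big_nil addr0 => az.
  have -> : z = a by apply/eqP; rewrite eq_le andbC.
  exact: ltW.
have p0 : 0 < p.1 by apply: pL; rewrite mem_head.
have pL' q : q \in L -> 0 < q.1 by move=> qL; apply: pL; rewrite in_cons qL orbT.
have grid m i : (i <= 4 ^ m)%N -> c < X (a + i%:R * (p.1 / (4 ^ m)%:R)) w.
  case: i => [_|i iN]; first by rewrite mul0r addr0.
  by have /visits_refine_cons[+ _ _] := h m; apply.
have [zp|pz] := leP z (a + p.1); last first.
  rewrite duration_cons addrA => /andP[_ ze]; apply: (IHL (a + p.1)).
  - by rewrite (le_trans sa)// lerDl ltW.
  - exact: pL'.
  - by have := grid 0%N 1%N; rewrite expn0 divr1 mul1r; exact.
  - by move=> m; have /visits_refine_cons[] := h m.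
  - by rewrite (ltW pz).
move=> /andP[az _]; rewrite leNgt; apply/negP => Xc.
have sz : s <= z by exact: le_trans az.
have : \forall y \near within `[s, +oo[ (nbhs z), X y w < c.
  have zs : `[s, +oo[%classic z by rewrite /= in_itv/= andbT.
  have /subspace_continuousP/(_ z zs) := cX.
  by move/cvgr_lt; apply.
move=> /nbhs_ballP[e /= e0 he].
have [m me] : exists m, p.1 / (4 ^ m)%:R < e.
  exists (Num.truncn (p.1 / e)).+1.
  rewrite ltr_pdivrMr ?ltr0n ?expn_gt0// mulrC -ltr_pdivrMr//.
  apply: (lt_le_trans (truncnS_gt _)); rewrite ler_nat.
  by apply/ltnW/ltn_expl.
set t := p.1 / _ in me.
have N0 : (0 < 4 ^ m)%N by rewrite expn_gt0.
have t0 : 0 < t by rewrite divr_gt0// ltr0n.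
have Nt : (4 ^ m)%:R * t = p.1 by rewrite /t mulrC divfK// pnatr_eq0 -lt0n.
have za0 : 0 <= (z - a) / t by rewrite divr_ge0 ?subr_ge0// ltW.
pose i := Num.truncn ((z - a) / t).
have i1 : i%:R * t <= z - a by rewrite -ler_pdivlMr// truncn_le.
have i2 : z - a < i%:R * t + t.
  have := truncnS_gt ((z - a) / t); rewrite -/i ltr_pdivrMr//.
  by rewrite -addn1 natrD mulrDl mul1r.
have iN : (i <= 4 ^ m)%N.
  rewrite -(ler_nat R) -(ler_pM2r t0) Nt (le_trans i1)// lerBlDl//.
have := grid m i iN; rewrite -/t ltNge => /negP; apply; apply: ltW.
apply: he => /=; last first.
  by rewrite in_itv/= andbT (le_trans sa)// lerDl mulr_ge0// ltW.
rewrite /ball/= ltr_norml; apply/andP; split; lra.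
Qed.

End grid_points.

(** * The event of survival *)

Section restricted_chains.
Context {R : realType}.
Notation mR := (measurableTypeR R).

Lemma chain_restrict_le (k : R -> R -> R -> R) (c : R) (L : seq (R * set mR)) h x :
  (forall t, jointly_measurable (k t)) -> (forall t x y, 0 <= k t x y) ->
  measurable_steps L -> measurable_fun [set: R] h -> (forall y, 0 <= h y)%E ->
  (chain k (restrict_steps c L) h x <= chain k L h x)%E.
Proof.
move=> mk k0 + mh h0; elim: L x => //= p L IHL x mpL.
have [mp mL] := measurable_steps_cons mpL.
have mL' : measurable_steps (restrict_steps c L).
  by move=> _ /mapP[q qL ->] /=; apply: measurableI => //; exact: mL.
have mpc : measurable (p.2 `&` `]c, +oo[%classic) by exact: measurableI.
apply: (@le_trans _ _ (kernel_op (k p.1) (p.2 `&` `]c, +oo[) (chain k L h) x)).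
  apply: le_kernel_op => //.
  - exact: measurable_chain.
  - exact: measurable_chain.
  - exact: chain_ge0.
  - by move=> y _; exact: IHL.
apply: ge0_subset_integral => //.
- by apply: measurable_kernel_integrand => //; exact: measurable_chain.
- by move=> y _; rewrite mule_ge0 ?lee_fin// chain_ge0.
Qed.

End restricted_chains.

Section survival.
Context {R : realType} d {T : measurableType d}.
Notation mR := (measurableTypeR R).
Notation leb := (@lebesgue_measure R).
Variables (P : probability T R) (B : R -> T -> R) (mu s0 v : R).
Hypothesis hB : brownian_after P B s0.
Notation X := (drifted mu B).
Implicit Types (L : seq (R * set mR)) (a : R) (w : T).

Let continuous_drifted w : {within `[s0, +oo[, continuous (X ^~ w)}.
Proof.
move=> z; apply: cvgD; first exact: (brownian_continuous hB).
by apply: continuous_subspaceT => y; exact: mulrl_continuous.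
Qed.

Definition above b : set T := [set w | v < path_min X s0 b w].

(** Only countably many times are observed, which gives measurability, and the
    margin between v and the j-th level leaves room to pass from the grid points
    to all times. *)
Definition above_grids L j : set T :=
  [set w | level v j < X s0 w] `&`
  \bigcap_m [set w | visits X (refine (level v j) m L) s0 w].

Lemma measurable_above_grids L j : measurable_steps L ->
  (forall p, p \in L -> 0 < p.1) -> measurable (above_grids L j).
Proof.
move=> mL pL; apply: measurableI.
  rewrite (_ : [set w | _] = X s0 @^-1` `]level v j, +oo[).
    exact: (measurable_preimage (measurable_drifted _ hB (lexx s0))).
  by apply/seteqP; split => w /=; rewrite in_itv/= andbT.
apply: bigcapT_measurable => m; apply: (measurable_visits mu hB) => //.
  exact: measurable_steps_refine.
exact: refine_gt0.
Qed.

(** A continuous path attains its minimum on a compact interval, so it stays above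
    v exactly when it stays above some level; density of the grids gives back all
    times, with a large inequality that the margin makes strict. *)
Lemma visits_above L : (forall p, p \in L -> 0 < p.1) ->
  [set w | visits X L s0 w] `&` above (s0 + duration L) =
  \bigcup_j above_grids L j.
Proof.
move=> pL; have dL := duration_ge0 pL.
have s0in : `[s0, s0 + duration L]%classic s0 by rewrite /= in_itv/= lexx lerDl.
apply/seteqP; split => w.
  move=> [hL hw]; have [j hj] := level_lt hw.
  have hlb : has_lbound [set X z w | z in `[s0, s0 + duration L]].
    have cw : {within `[s0, s0 + duration L], continuous (X ^~ w)}.
      apply: (continuous_subspaceW _ (@continuous_drifted w)).
      by apply: subset_itvl; rewrite bnd_simp.
    have [|c _ hc] := EVT_min _ cw; first by rewrite lerDl.
    by exists (X c w) => _ [z hz <-]; exact: hc.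
  have hX z : s0 <= z <= s0 + duration L -> level v j < X z w.
    move=> hz; apply: (lt_le_trans hj); apply: ge_inf => //.
    by exists z => //=; rewrite in_itv.
  exists j => //; split; first by apply: hX; rewrite lexx lerDl.
  by move=> m _; exact: above_visits_refine.
move=> [j _ [hs hg]]; split.
  exact: (visits_refine_last (hg 0%N I)).
apply: (@lt_le_trans _ _ (level v j)); first exact: level_gt.
apply: lb_le_inf; first by exists (X s0 w), s0.
move=> _ [z hz <-]; apply: (visits_refine_above (lexx s0) pL) => //.
by move=> m; exact: hg.
Qed.

Lemma measurable_above b : s0 < b -> measurable (above b).
Proof.
move=> sb; pose L := [:: (b - s0, [set: mR])].
have dL : s0 + duration L = b.
  by rewrite /L duration_cons /duration big_nil addr0 addrC subrK.
have pL p : p \in L -> 0 < p.1 by rewrite mem_seq1 => /eqP ->; rewrite subr_gt0.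
have mL : measurable_steps L by move=> p; rewrite mem_seq1 => /eqP ->; exact: measurableT.
have <- : [set w | visits X L s0 w] `&` above (s0 + duration L) = above b.
  by rewrite dL; apply/seteqP; split => w; [case|move=> h; split].
rewrite visits_above//; apply: bigcupT_measurable => j.
exact: measurable_above_grids.
Qed.

Variable x : R.
Hypotheses (hx : P [set w | X s0 w = x] = 1%E) (vx : v < x).

Let c L : R := expR (- (mu * x + mu ^+ 2 * duration L / 2)).

Let eq_chain (k k' : R -> R -> R -> R) L h : (forall p, p \in L -> 0 < p.1) ->
  (forall t y z, 0 < t -> k t y z = k' t y z) -> chain k L h = chain k' L h.
Proof.
move=> + kk'; elim: L => [|p L IHL] pL; first by rewrite /chain /=.
have p0 : 0 < p.1 by apply: pL; rewrite mem_head.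
rewrite [LHS]/= [RHS]/= IHL; last by move=> q qL; apply: pL; rewrite in_cons qL orbT.
apply/funext => y; rewrite /kernel_op; apply: eq_integral => z _.
by rewrite kk'.
Qed.

Let probability_refine b m L : measurable_steps L ->
  (forall p, p \in L -> 0 < p.1) ->
  P [set w | visits X (refine b m L) s0 w] =
  ((c L)%:E * chain heat (refine b m L) (endpoint_tilt mu) x)%E.
Proof.
move=> mL pL; have pr := @refine_gt0 R b m L pL.
have mr := @measurable_steps_refine R b m L mL.
rewrite (probability_visits hB hx)//.
rewrite (eq_chain (k' := tilted mu heat))//; last first.
  by move=> t y z t0; exact: drifted_heatE.
rewrite chain_tilted//.
- by rewrite duration_refine.
- exact: measurable_heat.
- by move=> *; exact: heat_ge0.
Qed.

Let l := `|mu| + 1.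
Let l0 : 0 < l. Proof. by rewrite ltr_wpDl. Qed.

Let endpoint_tilt_le b y : b < y ->
  (endpoint_tilt mu y <= (expR (mu * b) * expat b l y)%:E)%E.
Proof.
move=> by_; rewrite lee_fin /expat -expRD ler_expR.
rewrite -lerBlDl -mulrBr; apply: ler_wpM2r; first by rewrite subr_ge0 ltW.
by apply: le_trans (ler_norm mu) _; rewrite lerDl.
Qed.

Let c_ge0 L : (0 <= (c L)%:E)%E. Proof. by rewrite lee_fin expR_ge0. Qed.

(** The grids decrease with m, so the bound of each killed walk from below by the
    absorbed semigroup of the same level passes to the limit. *)
Let above_grids_ge L j : measurable_steps L -> (forall p, p \in L -> 0 < p.1) ->
  level v j < x ->
  ((c L)%:E * chain (absorb (level v j)) L (endpoint_tilt mu) x <=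
   P (above_grids L j))%E.
Proof.
move=> mL pL jx.
pose F m := [set w | level v j < X s0 w] `&` [set w | visits X (refine (level v j) m L) s0 w].
have mS : measurable [set w | level v j < X s0 w].
  rewrite (_ : [set w | _] = X s0 @^-1` `]level v j, +oo[).
    exact: (measurable_preimage (measurable_drifted _ hB (lexx s0))).
  by apply/seteqP; split => w /=; rewrite in_itv/= andbT.
have mV m : measurable [set w | visits X (refine (level v j) m L) s0 w].
  apply: (measurable_visits mu hB) => //; first exact: measurable_steps_refine.
  exact: refine_gt0.
have mF m : measurable (F m) by exact: measurableI.
have -> : above_grids L j = \bigcap_m F m.
  apply/seteqP; split => w; first by move=> [h1 h2] m _; split => //; exact: h2.
  by move=> h; split; [case: (h 0%N I)|move=> m _; case: (h m I)].
have PF m : P (F m) = P [set w | visits X (refine (level v j) m L) s0 w].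
  rewrite (probability_start_setI hB hx)// [RHS](probability_start_setI hB hx)//.
  congr (P _); apply/seteqP; split => w; first by move=> [[]].
  move=> [h Xw]; split => //; split => //.
  have jw : level v j < X s0 w by rewrite Xw.
  exact: jw.
have cF : P (F m) @[m --> \oo] --> P (\bigcap_m F m).
  apply: nonincreasing_cvg_mu => //.
  - by rewrite ltey_eq fin_num_measure.
  - exact: bigcapT_measurable.
  - apply/nonincreasing_seqP => m; apply/subsetPset => w [h1 h2]; split => //.
    exact: visits_refineS.
rewrite -(cvg_lim _ cF)//; apply: lime_ge; first by apply/cvg_ex; eexists; exact: cF.
apply: nearW => m; rewrite PF probability_refine//; apply: lee_wpmul2l => //.
exact: (absorb_chain_le_refine (expR_ge0 (mu * level v j))
  (measurable_endpoint_tilt mu) (endpoint_tilt_ge0 mu)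
  (@endpoint_tilt_le (level v j)) m mL pL jx).
Qed.

(** On this event the targets may be cut at the j-th level, which is a gap above
    v: the killed walk at level v is then close to the absorbed semigroup. *)
Let above_grids_le L j : measurable_steps L -> (forall p, p \in L -> 0 < p.1) ->
  (P (above_grids L j) <= (c L)%:E * chain (absorb v) L (endpoint_tilt mu) x)%E.
Proof.
move=> mL pL; pose L' := restrict_steps (level v j) L.
have mL' : measurable_steps L'.
  move=> p /mapP[q qL ->] /=; apply: measurableI => //; exact: mL.
have pL' p : p \in L' -> 0 < p.1 by move=> /mapP[q qL ->] /=; exact: pL.
have dL' : duration L' = duration L by rewrite /duration big_map.
have gL' p : p \in L' -> forall y, p.2 y -> v + j.+1%:R^-1 < y.
  by move=> /mapP[q qL ->] y [_] /=; rewrite in_itv/= andbT.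
have chainL' : (chain (absorb v) L' (endpoint_tilt mu) x <=
                chain (absorb v) L (endpoint_tilt mu) x)%E.
  apply: chain_restrict_le => //.
  - exact: measurable_absorb.
  - by move=> *; exact: absorb_ge0.
  - exact: measurable_endpoint_tilt.
  - exact: endpoint_tilt_ge0.
apply/lee_addgt0Pr => e e0.
have cL0 : 0 < c L by exact: expR_gt0.
have ec : 0 < e / c L by rewrite divr_gt0.
have j0 : 0 < j.+1%:R^-1 :> R by rewrite invr_gt0.
have [m Hm] := refine_le_absorb_chain l0 (expR_ge0 (mu * v))
  (measurable_endpoint_tilt mu) (endpoint_tilt_ge0 mu)
  (endpoint_tilt_le (b := v)) j0 ec mL' pL' gL'.
apply: (@le_trans _ _ (P [set w | visits X (refine v m L') s0 w])).
  apply: le_measure; rewrite ?inE.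
  - exact: measurable_above_grids.
  - apply: (measurable_visits mu hB) => //; first exact: measurable_steps_refine.
    exact: refine_gt0.
  - move=> w [_ h]; apply: (@visits_refine_level _ _ _ _ (level v j)).
      exact/ltW/level_gt.
    apply: visits_refine_restrict; exact: h.
rewrite probability_refine// /c dL' -/(c L).
have -> : e%:E = ((c L)%:E * (e / c L)%:E)%E by rewrite -EFinM mulrC divfK// gt_eqF.
rewrite -ge0_muleDr; last 2 first.
- by apply: chain_ge0; [move=> *; exact: absorb_ge0|exact: endpoint_tilt_ge0].
- by rewrite lee_fin ltW.
apply: lee_wpmul2l => //; apply: le_trans (Hm m (leqnn m) x vx) _.
by apply: leeD.
Qed.

(** The probabilities of the events [above_grids] increase to the left-hand side;
    they lie between the chains absorbed at the j-th level and at v, and the former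
    converge to the latter. *)
Lemma probability_visits_above L : measurable_steps L ->
  (forall p, p \in L -> 0 < p.1) ->
  P ([set w | visits X L s0 w] `&` above (s0 + duration L)) =
  ((expR (- (mu * x + mu ^+ 2 * duration L / 2)))%:E *
   chain (absorb v) L (endpoint_tilt mu) x)%E.
Proof.
move=> mL pL; rewrite visits_above//.
have mG j : measurable (above_grids L j) by exact: measurable_above_grids.
have cG : P (above_grids L j) @[j --> \oo] --> P (\bigcup_j above_grids L j).
  apply: nondecreasing_cvg_mu => //; first exact: bigcupT_measurable.
  apply/nondecreasing_seqP => j; apply/subsetPset => w [h1 h2].
  have lj : level v j.+1 <= level v j by exact: level_nonincreasing.
  split; first exact: le_lt_trans h1.
  by move=> m _; apply: visits_refine_level (h2 m I).
have cC : ((c L)%:E * chain (absorb (level v j)) L (endpoint_tilt mu) x)%E @[j --> \oo]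
    --> ((c L)%:E * chain (absorb v) L (endpoint_tilt mu) x)%E.
  apply: cvgeZl => //; apply: absorb_chain_cvg => //.
  - exact: measurable_endpoint_tilt.
  - exact: endpoint_tilt_ge0.
rewrite -/(c L) -(cvg_lim _ cG)//; apply/cvg_lim => //.
have [j0 hj0] := level_lt vx.
apply: (squeeze_cvge _ cC (cvg_cst _)).
near=> j; rewrite above_grids_ge ?above_grids_le//.
rewrite (le_lt_trans _ hj0)//; apply: level_nonincreasing.
by near: j; exists j0.
Unshelve. all: by end_near. Qed.

End survival.

(** * Densities on tuples *)

Section density_measure.
Context d (T : measurableType d) (R : realType).
Variables (m : {measure set T -> \bar R}) (F : T -> \bar R).
Hypotheses (mF : measurable_fun [set: T] F) (F0 : forall y, (0 <= F y)%E).

Definition density_measure of measurable_fun [set: T] F & (forall y, (0 <= F y)%E) :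
  set T -> \bar R := fun A => (\int[m]_(y in A) F y)%E.

Notation nu := (density_measure mF F0).

Let nu0 : nu set0 = 0%E. Proof. exact: integral_set0. Qed.

Let nu_ge0 A : (0 <= nu A)%E. Proof. exact: integral_ge0. Qed.

Let nu_sigma_additive : semi_sigma_additive nu.
Proof.
move=> A mA tA mUA; rewrite /density_measure ge0_integral_bigcup//; last first.
  exact: measurable_funTS.
by apply: is_cvg_ereal_nneg_natsum => i _; exact: integral_ge0.
Qed.

HB.instance Definition _ := isMeasure.Build _ _ _ nu nu0 nu_ge0 nu_sigma_additive.

End density_measure.

Section tuple_chains.
Context {R : realType}.
Notation mR := (measurableTypeR R).
Notation leb := (@lebesgue_measure R).

Lemma integral_lebesgue_tuple_cons n (F : n.+1.-tuple mR -> \bar R) :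
  measurable_fun [set: n.+1.-tuple mR] F -> (forall y, 0 <= F y)%E ->
  (\int[lebesgue_tuple n.+1]_y F y =
   \int[leb]_a \int[lebesgue_tuple n]_z F (cons_pair (a, z)))%E.
Proof.
move=> mF F0.
have mFc : measurable_fun [set: mR * n.-tuple mR] (F \o @cons_pair R n).
  exact: measurableT_comp mF (@measurable_cons_pair R n).
rewrite -[RHS](fubini_tonelli1 (m1 := leb) (m2 := lebesgue_tuple n) (F \o @cons_pair R n) mFc);
  last by move=> z; exact: F0.
by rewrite -[RHS](ge0_integral_pushforward (@measurable_cons_pair R n) _ measurableT mF).
Qed.

Variables (k : R -> R -> R -> R) (q : R -> \bar R).
Hypotheses (mk : forall t, jointly_measurable (k t)) (k0 : forall t x y, 0 <= k t x y).
Hypotheses (mq : measurable_fun [set: R] q) (q0 : forall y, (0 <= q y)%E).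

Definition steps n (s : nat -> R) (A : nat -> set mR) : seq (R * set mR) :=
  mkseq (fun i => (s i.+1 - s i, A i)) n.

Lemma steps_cons n s A : steps n.+1 s A =
  (s 1%N - s 0%N, A 0%N) :: steps n (fun i => s i.+1) (fun i => A i.+1).
Proof.
rewrite /steps /mkseq /=; congr cons.
by rewrite (_ : 1%N = 1 + 0)%N// iotaDl -map_comp.
Qed.

Definition position n (x : R) (j : nat) (y : n.-tuple mR) : R := nth 0 (x :: y) j.

Lemma measurable_position n x j : measurable_fun [set: n.-tuple mR] (@position n x j).
Proof.
case: j => [|i]; first exact: measurable_cst.
have [iN|Ni] := ltnP i n.
  rewrite (_ : position x i.+1 = fun y => tnth y (Ordinal iN)).
    exact: (@measurable_tnth _ mR).
  by apply/funext => y; rewrite (tnth_nth 0).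
rewrite (_ : position x i.+1 = cst 0); first exact: measurable_cst.
by apply/funext => y; rewrite /position /= nth_default// size_tuple.
Qed.

Definition path_density n (s : nat -> R) (x : R) (y : n.-tuple mR) : \bar R :=
  ((\prod_(j < n) k (s j.+1 - s j) (position x j y) (position x j.+1 y))%:E *
   q (position x n y))%E.

Lemma path_density_ge0 n s x (y : n.-tuple mR) : (0 <= path_density s x y)%E.
Proof. by rewrite mule_ge0// lee_fin prodr_ge0. Qed.

Lemma measurable_path_density n s x :
  measurable_fun [set: n.-tuple mR] (path_density s x).
Proof.
apply: emeasurable_funM; last exact: measurableT_comp mq (measurable_position _ _).
apply/measurable_EFinP; apply: measurable_prod => j _.
have mc : measurable_fun [set: n.-tuple mR]
    (fun y => (position x j y, position x j.+1 y) : mR * mR).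
  by apply: measurable_fun_pair; exact: measurable_position.
exact: (measurableT_comp (mk _) mc).
Qed.

Lemma path_density_cons n s x a (z : n.-tuple mR) :
  path_density s x (cons_pair (a, z)) =
  ((k (s 1%N - s 0%N) x a)%:E * path_density (fun i => s i.+1) a z)%E.
Proof.
by rewrite /path_density big_ord_recl EFinM -muleA.
Qed.

Lemma integral_box_path_density n s x (A : nat -> set mR) :
  (forall i, measurable (A i)) ->
  (\int[lebesgue_tuple n]_(y in box (fun i : 'I_n => A i)) path_density s x y =
   chain k (steps n s A) q x)%E.
Proof.
elim: n s x A => [|n IHn] s x A mA.
  rewrite (_ : box _ = setT); last by apply/seteqP; split => // y _ [].
  rewrite integral_dirac//; last exact: measurable_path_density.
  by rewrite diracT mul1e /path_density big_ord0 mul1e.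
have mb m (A' : nat -> set mR) : (forall i, measurable (A' i)) ->
    measurable (box (fun i : 'I_m => A' i)) by move=> mA'; exact: measurable_box.
rewrite integral_mkcond integral_lebesgue_tuple_cons; last 2 first.
- apply/(measurable_restrictT _ _).1; first exact: mb.
  by apply: measurable_funTS; exact: measurable_path_density.
- by move=> y; apply: erestrict_ge0 => z _; exact: path_density_ge0.
rewrite steps_cons /=.
rewrite /kernel_op [RHS]integral_mkcond; apply: eq_integral => a _.
rewrite /patch; case: ifPn => [/set_mem Aa|nAa]; last first.
  apply: integral0_eq => z _; rewrite ifF//; apply/negP => /set_mem /(_ ord0).
  by move: nAa => /negP + h; apply; rewrite inE.
transitivity (\int[lebesgue_tuple n]_(z in box (fun i : 'I_n => A i.+1))
    ((k (s 1%N - s 0%N) x a)%:E * path_density (fun i => s i.+1) a z))%E.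
  rewrite [RHS]integral_mkcond; apply: eq_integral => z _.
  rewrite /patch path_density_cons; congr (if _ then _ else _).
  apply/idP/idP => /set_mem h; apply/mem_set.
    by move=> i; have := h (lift ord0 i); rewrite /cons_pair tnthS.
  by move=> i; have [j ->|->] := unliftP ord0 i; rewrite /cons_pair ?tnthS ?theadE//; exact: h.
rewrite ge0_integralZl_EFin//; last 3 first.
- exact: (mb _ (fun i => A i.+1)).
- by move=> z _; exact: path_density_ge0.
- by apply: measurable_funTS; exact: measurable_path_density.
by congr (_ * _)%E; rewrite (IHn (fun i => s i.+1) a (fun i => A i.+1)).
Qed.

End tuple_chains.

(** * The law of the absorbed path *)

Section absorbed_path_law.
Context {R : realType} d {T : measurableType d}.
Notation mR := (measurableTypeR R).
Notation leb := (@lebesgue_measure R).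
Variables (mu v : R).

(** The transition kernel of the drifted process absorbed at v. *)
Definition absorbed : R -> R -> R -> R := tilted mu (absorb v).

Lemma jointly_measurable_absorbed t : jointly_measurable (absorbed t).
Proof.
apply: measurable_funM; last exact: measurable_absorb.
apply: measurableT_comp => //; apply: measurable_funB => //.
by apply: measurable_funM => //; exact: measurable_funB.
Qed.

Lemma absorbed_ge0 t x y : 0 <= absorbed t x y.
Proof. by rewrite mulr_ge0 ?absorb_ge0// ltW// tilt_gt0. Qed.

Lemma absorbedE t x y : 0 < t -> v < x -> v < y ->
  absorbed t x y = drifted_killed_kernel mu v t x y.
Proof. by move=> t0 vx vy; rewrite drifted_killed_kernelE// /absorbed /tilted absorbE. Qed.

Definition survival t : R -> \bar R :=
  chain absorbed [:: (t, [set: mR])] (cst 1%E).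

Let measurable_survival_step t : measurable_steps [:: (t, [set: mR])].
Proof. by move=> p; rewrite mem_seq1 => /eqP ->; exact: measurableT. Qed.

Lemma survival_ge0 t x : (0 <= survival t x)%E.
Proof. by apply: chain_ge0 => // *; exact: absorbed_ge0. Qed.

Lemma measurable_survival t : measurable_fun [set: R] (survival t).
Proof.
apply: measurable_chain => //; first exact: jointly_measurable_absorbed.
by move=> *; exact: absorbed_ge0.
Qed.

Variables (P : probability T R) (B : R -> T -> R) (x : R).
Notation X := (drifted mu B).

Lemma probability_visits_absorbed s0 L : brownian_after P B s0 ->
  P [set w | X s0 w = x] = 1%E -> v < x -> measurable_steps L ->
  (forall p, p \in L -> 0 < p.1) ->
  P ([set w | visits X L s0 w] `&` above B mu s0 v (s0 + duration L)) =
  chain absorbed L (cst 1%E) x.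
Proof.
move=> hB hx vx mL pL; rewrite (probability_visits_above hB hx)//.
rewrite chain_tilted//; first exact: measurable_absorb.
by move=> *; exact: absorb_ge0.
Qed.

Lemma probability_above s0 b : brownian_after P B s0 ->
  P [set w | X s0 w = x] = 1%E -> v < x -> s0 < b ->
  P (above B mu s0 v b) = survival (b - s0) x.
Proof.
move=> hB hx vx sb.
rewrite /survival -(@probability_visits_absorbed s0)//.
- congr (P _); rewrite duration_cons /duration big_nil addr0 (addrC s0) subrK.
  by apply/seteqP; split => w; [move=> h; split|case].
- by move=> p; rewrite mem_seq1 => /eqP ->; rewrite subr_gt0.
Qed.

Lemma survivalE t y : v < y ->
  survival t y =
  ((expR (- (mu * y + mu ^+ 2 * t / 2)))%:E *
   \int[leb]_(z in `]v, +oo[) (killed_kernel v t y z * expR (mu * z))%:E)%E.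
Proof.
move=> vy; rewrite /survival chain_tilted//; last 2 first.
- exact: measurable_absorb.
- by move=> *; exact: absorb_ge0.
rewrite duration_cons /duration big_nil addr0; congr (_ * _)%E.
rewrite /= absorb_op_restrict; apply: eq_integral => z.
rewrite /patch in_setT.
by rewrite inE /= in_itv/= andbT => vz; rewrite absorbE// EFinM.
Qed.

Variables (n : nat) (s : nat -> R) (t : R).
Hypotheses (hB : brownian_after P B (s 0%N)) (hx : P [set w | X (s 0%N) w = x] = 1%E).
Hypotheses (vx : v < x) (hs : forall j, (j < n)%N -> s j < s j.+1) (hst : s n < t).

Let visits_steps m (r : nat -> R) (A : nat -> set mR) w :
  visits X (steps m r A) (r 0%N) w <->
  forall i, (i < m)%N -> A i (X (r i.+1) w).
Proof.
elim: m r A => [|m IHm] r A; first by split.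
rewrite steps_cons /= (addrC (r 0%N)) subrK.
rewrite (IHm (fun i => r i.+1) (fun i => A i.+1)); split.
  by move=> [h0 h] [|i] im //; exact: h.
by move=> h; split; [exact: h|move=> i im; exact: h].
Qed.

Let duration_steps m (r : nat -> R) (A : nat -> set mR) :
  duration (steps m r A) = r m - r 0%N.
Proof.
rewrite /duration /steps /mkseq big_map -[m in iota 0 m]subn0.
exact: telescope_sumr.
Qed.

Let s_le j : (j <= n)%N -> s 0%N <= s j.
Proof.
elim: j => // j IHj jn; apply: le_trans (IHj (ltnW jn)) _.
exact/ltW/hs.
Qed.

Let measurable_positions :
  measurable_fun [set: T]
    (fun w => [tuple X (s i.+1) w | i < n] : n.-tuple mR).
Proof.
apply/measurable_fun_tnthP => i.
rewrite (_ : _ \o _ = X (s i.+1)); last by apply/funext => w /=; rewrite tnth_mktuple.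
exact: (measurable_drifted mu hB (s_le (ltn_ord i))).
Qed.

Lemma measurable_preimage_positions (W : set (n.-tuple mR)) : measurable W ->
  measurable ((fun w => [tuple X (s i.+1) w | i < n]) @^-1` W).
Proof. by move=> mW; rewrite -[X in measurable X]setTI; exact: measurable_positions. Qed.

(** Both sides are finite measures in W. On a box, the left-hand side is a visit
    event to which a last unconstrained step from s n to t is added, and the
    right-hand side is the same chain of integrals. *)
Lemma law_absorbed_path (W : set (n.-tuple mR)) : measurable W ->
  (P ((fun w => [tuple X (s i.+1) w | i < n]) @^-1` W `&` above B mu (s 0%N) v t) =
   \int[lebesgue_tuple n]_(y in W)
     path_density absorbed (survival (t - s n)) s x y)%E.
Proof.
move=> mW; have mE : measurable (above B mu (s 0%N) v t).
  exact: (measurable_above mu v hB (le_lt_trans (s_le (leqnn n)) hst)).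
pose Y w : n.-tuple mR := [tuple X (s i.+1) w | i < n].
have mY : measurable_fun [set: T] Y by exact: measurable_positions.
pose F : n.-tuple mR -> \bar R := path_density absorbed (survival (t - s n)) s x.
have mF : measurable_fun [set: n.-tuple mR] F.
  apply: measurable_path_density.
  - exact: jointly_measurable_absorbed.
  - exact: measurable_survival.
have F0 y : (0 <= F y)%E.
  apply: path_density_ge0; first exact: absorbed_ge0.
  exact: survival_ge0.
rewrite -[LHS]/(restricted_law P mE mY W).
rewrite -[RHS]/(density_measure (lebesgue_tuple n) mF F0 W).
apply: tuple_measure_unique mW; first by rewrite ltey_eq fin_num_measure.
move=> A mA; pose A' (i : nat) : set mR := oapp A setT (insub i).
have A'E (i : 'I_n) : A' i = A i by rewrite /A' valK.
have mA' i : measurable (A' i).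
  by rewrite /A'; case: insubP => [j _ _|_]; [exact: mA|exact: measurableT].
have boxE : box A = box (fun i : 'I_n => A' i).
  by congr box; apply/funext => i; rewrite A'E.
rewrite -[RHS]/(\int[lebesgue_tuple n]_(y in box A) F y)%E boxE.
rewrite integral_box_path_density//; last 4 first.
- exact: jointly_measurable_absorbed.
- exact: absorbed_ge0.
- exact: measurable_survival.
- exact: survival_ge0.
rewrite /survival -chain_cat; set L := _ ++ _.
have mL : measurable_steps L.
  move=> p; rewrite mem_cat => /orP[/mapP[i _ ->]//=|]; exact: measurable_survival_step.
have pL p : p \in L -> 0 < p.1.
  rewrite mem_cat => /orP[/mapP[i + ->]|].
    by rewrite mem_iota add0n => /andP[_ iN] /=; rewrite subr_gt0 hs.
  by rewrite mem_seq1 => /eqP -> /=; rewrite subr_gt0.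
have dL : s 0%N + duration L = t.
  rewrite duration_cat duration_steps duration_cons /duration big_nil addr0.
  by rewrite addrC -addrA (addrC (t - _)) addrA; lra.
rewrite -(probability_visits_absorbed hB hx vx mL pL) dL.
rewrite -[LHS]/(P (Y @^-1` _ `&` _)); congr (P (_ `&` _)).
apply/seteqP; split => w /=.
  move=> h; apply/visits_cat; split => //; apply/visits_steps => i iN.
  by have := h (Ordinal iN); rewrite tnth_mktuple.
move=> /visits_cat[/visits_steps h _] i.
by rewrite tnth_mktuple; exact: h.
Qed.

End absorbed_path_law.

(** * The conditional density *)

Lemma prod_tilt (R : realType) (mu : R) (n : nat) (s y : nat -> R) :
  \prod_(j < n) tilt mu (s j.+1 - s j) (y j) (y j.+1) =
  tilt mu (s n - s 0%N) (y 0%N) (y n).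
Proof.
elim: n => [|n IHn].
  by rewrite big_ord0 /tilt !subrr !(mulr0, mul0r) subr0 expR0.
rewrite big_ord_recr /= IHn tiltM (_ : s n - s 0%N + _ = s n.+1 - s 0%N)//.
by rewrite addrC addrA subrK.
Qed.

Lemma fine_mul_gt0 (R : realType) (c : R) (z : \bar R) :
  0 < c -> fine (c%:E * z) = c * fine z.
Proof.
move=> c0; case: z => [r| |] //=; rewrite ?mulr0.
- by rewrite gt0_muley ?lte_fin.
- by rewrite gt0_muleNy ?lte_fin.
Qed.

Theorem theorem3p1 (R : realType) (d : measure_display) (T : measurableType d)
    (mu : R) (B : R -> T -> R) (Pr : R -> R -> probability T R)
    (hB : drifted_brownian_laws mu B Pr)
    (u v t : R) (hvu : v < u) (ht : 0 < t)
    (n : nat) (hn : (1 <= n)%N)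
    (s : nat -> R) (hs0 : s 0%N = 0)
    (hs : forall j, (j < n)%N -> s j < s j.+1) (hst : s n < t) :
  let Bmu := drifted mu B in
  (* y_j, with y_0 = u *)
  let yy (y : n.-tuple (measurableTypeR R)) (j : nat) : R := nth 0 (u :: y) j in
  (* the event that the minimum of B^mu over [a, t] is > v *)
  let above (a : R) : set T := [set w | v < path_min Bmu a t w] in
  let D : set (n.-tuple (measurableTypeR R)) :=
    [set y | forall i, v < tnth y i] in
  let f (y : n.-tuple (measurableTypeR R)) : R :=
    (\prod_(1 <= j < n.+1)
       drifted_killed_kernel mu v (s j - s j.-1) (yy y j.-1) (yy y j))
    * (fine (Pr (s n) (yy y n) (above (s n))) / fine (Pr 0 u (above 0))) in
  joint_cond_density (Pr 0 u) (above 0)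
    (fun w => [tuple Bmu (s i.+1) w | i < n]) D f
  /\
  forall y, D y ->
    f y =
    (\prod_(1 <= j < n.+1)
       killed_kernel v (s j - s j.-1) (yy y j.-1) (yy y j))
    * ((\int[lebesgue_measure]_(x in `]v, +oo[)
          (killed_kernel v (t - s n) (yy y n) x * expR (mu * x)))
       / (\int[lebesgue_measure]_(x in `]v, +oo[)
            (killed_kernel v t u x * expR (mu * x)))).
Proof.
move=> Bmu yy above' D f.
have sS i j : (i <= j)%N -> (j <= n)%N -> s i <= s j.
  elim: j => [|j IHj]; first by rewrite leqn0 => /eqP ->.
  rewrite leq_eqVlt => /orP[/eqP -> //|ij] jn.
  by apply: le_trans (IHj ij (ltnW jn)) _; exact/ltW/hs.
have sn0 : 0 <= s n by rewrite -hs0 sS.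
have [hB0' hx0'] := hB 0 u (lexx _).
have hB0 : brownian_after (Pr 0 u) B (s 0%N) by rewrite hs0.
have hx0 : Pr 0 u [set w | drifted mu B (s 0%N) w = u] = 1%E by rewrite hs0.
have yyE y j : yy y j = position u j y by [].
have yv y j : D y -> (j <= n)%N -> v < yy y j.
  move=> Dy; case: j => [//|i iN].
  by have := Dy (Ordinal iN); rewrite (tnth_nth 0).
have aboveE x : v < x -> Pr (s n) x (above' (s n)) = survival mu v (t - s n) x.
  move=> vx; have [hBn hxn] := hB (s n) x sn0.
  exact: (probability_above hBn hxn vx hst).
have above0E : Pr 0 u (above' 0) = survival mu v t u.
  have [hBn hxn] := hB 0 u (lexx _).
  by rewrite -{1}(subr0 t) -(probability_above hBn hxn hvu ht).
pose F : n.-tuple (measurableTypeR R) -> \bar R :=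
  path_density (absorbed mu v) (survival mu v (t - s n)) s u.
have mF : measurable_fun setT F.
  apply: measurable_path_density.
  - exact: jointly_measurable_absorbed.
  - exact: measurable_survival.
have F0 y : (0 <= F y)%E.
  by apply: path_density_ge0; [exact: absorbed_ge0|exact: survival_ge0].
pose Z := fine (Pr 0 u (above' 0)).
have Z0 : 0 <= Z by rewrite fine_ge0.
have FE y : D y -> F y = ((\prod_(1 <= j < n.+1)
     drifted_killed_kernel mu v (s j - s j.-1) (yy y j.-1) (yy y j)) *
     fine (Pr (s n) (yy y n) (above' (s n))))%:E.
  move=> Dy; rewrite /F /path_density EFinM; congr (_%:E * _)%E.
    rewrite big_add1 /= big_mkord; apply: eq_bigr => j _.
    by rewrite absorbedE// ?subr_gt0 ?hs// -yyE yv// ltnW.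
  rewrite -yyE -aboveE ?yv// fineK// fin_num_measure//.
  have [hBn _] := hB (s n) (yy y n) sn0.
  exact: (measurable_above mu v hBn hst).
have fE y : D y -> f y = fine (F y) * Z^-1.
  by move=> Dy; rewrite FE//= /f mulrA.
have FfE y : D y -> (f y)%:E = (F y * (Z^-1)%:E)%E.
  by move=> Dy; rewrite fE// EFinM fineK// FE.
have mD : measurable D.
  rewrite (_ : D = box (fun=> `]v, +oo[%classic)).
    by apply: measurable_box.
  by apply/seteqP; split => y Dy i; have := Dy i; rewrite /= in_itv/= andbT.
split; first split.
- apply: (eq_measurable_fun (fun y => fine (F y) * Z^-1)).
    by move=> y /set_mem Dy; rewrite fE.
  apply: measurable_funTS; apply: measurable_funM => //.
  exact: (measurableT_comp (fine_measurable measurableT) mF).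
- by move=> y Dy; rewrite fE// mulr_ge0 ?invr_ge0// fine_ge0.
- move=> A mA AD; rewrite /cond_prob -/Z.
  have law := law_absorbed_path hB0 hx0 hvu hs hst mA.
  rewrite hs0 in law.
  transitivity (\int[lebesgue_tuple n]_(y in A) (F y * (Z^-1)%:E))%E; last first.
    by apply: eq_integral => y /set_mem /AD Dy; rewrite FfE.
  rewrite ge0_integralZr//; last 2 first.
  + exact: measurable_funTS.
  + by rewrite lee_fin invr_ge0.
  rewrite -law EFinM fineK// fin_num_measure//; apply: measurableI.
    exact: (measurable_preimage_positions mu hB0 hs mA).
  exact: (measurable_above mu v hB0' ht).
move=> y Dy; rewrite /f.
have -> : \prod_(1 <= j < n.+1)
    drifted_killed_kernel mu v (s j - s j.-1) (yy y j.-1) (yy y j) =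
  tilt mu (s n) u (yy y n) * \prod_(1 <= j < n.+1)
    killed_kernel v (s j - s j.-1) (yy y j.-1) (yy y j).
  rewrite !big_add1 /= !big_mkord.
  under eq_bigr => j _ do rewrite drifted_killed_kernelE ?subr_gt0 ?hs//.
  by rewrite big_split /= (prod_tilt mu n s (yy y)) hs0 subr0.
rewrite aboveE ?yv// /Z above0E !survivalE ?yv// !fine_mul_gt0 ?expR_gt0//.
rewrite -/(Rintegral _ _ _) -/(Rintegral _ _ _).
set I1 := Rintegral _ _ _; set I0 := Rintegral _ _ _.
set p := \prod_(_ <= _ < _) _.
set e1 := expR (- (mu * yy y n + _)); set e0 := expR (- (mu * u + _)).
(* the drift factors of the path up to s n and of the survival after s n make up
   the one of the whole interval *)
have E : tilt mu (s n) u (yy y n) * e1 = e0.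
  by rewrite /tilt /e1 /e0 -expRD; congr expR; lra.
have e00 : e0 != 0 by rewrite gt_eqF ?expR_gt0.
rewrite invfM; move: (I0^-1) => J.
have -> : tilt mu (s n) u (yy y n) * p * (e1 * I1 * (e0^-1 * J)) =
    (tilt mu (s n) u (yy y n) * e1) * e0^-1 * (p * (I1 * J)).
  by move: (tilt _ _ _ _) (e0^-1) => a b; ring.
by rewrite E divff// mul1r.
Qed.
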